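(* Let $G$ be a finitely generated group, and let $T_1,\dots,T_n$ be irreducible minimal $\mathbb{R}$-trees with isometric actions of $G$ such that $T_i$ is compatible with $T_j$ for all $i\neq j$. Then there exists a common refinement $T$ of all the $T_i$'s; that is, there exist an $\mathbb{R}$-tree $T$ with an isometric action of $G$ and, for each $i$, a $G$-equivariant map $T\to T_i$ preserving alignment.
   Context: An $\mathbb{R}$-tree is a geodesic metric space in which any two distinct points are connected by a unique topological arc; all $\mathbb{R}$-trees carry an isometric action of $G$. The action is minimal if there is no proper $G$-invariant subtree. An element $g\in G$ is hyperbolic if $\min_{x\in T}d(x,gx)>0$; it then has an axis, an invariant line on which it translates. $T$ is irreducible if there are two hyperbolic elements $g,h\in G$ whose axes have intersection of finite length (possibly empty). A map $f:T\to T'$ preserves alignment (is a collapse map) if the image of any segment $[a,b]$ is the segment $[f(a),f(b)]$ (possibly a point). Two $\mathbb{R}$-trees $T_i,T_j$ are compatible if there exist an $\mathbb{R}$-tree $\hat T$ with an isometric action of $G$ and $G$-equivariant maps $\hat T\to T_i$ and $\hat T\to T_j$ preserving alignment. *)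

(* Defs.v *)
From HB Require Import structures.
From mathcomp Require Import all_boot all_order all_algebra.
From mathcomp Require Import boolp classical_sets reals topology normedtype.

Set Implicit Arguments.
Unset Strict Implicit.
Unset Printing Implicit Defensive.

Import Order.TTheory GRing.Theory Num.Theory.
Import numFieldNormedType.Exports.

Local Open Scope classical_set_scope.
Local Open Scope ring_scope.

Definition subgroup (G : groupType) (H : set G) : Prop :=
  [/\ H 1%g, (forall x y : G, H x -> H y -> H (x * y)%g) &
      forall x : G, H x -> H (x^-1)%g].

Definition finitely_generated (G : groupType) : Prop :=
  exists s : seq G, forall H : set G,
    subgroup H -> [set` s] `<=` H -> H = setT.

Section MetricTrees.
Variables (R : realType) (T : metricType R).
Implicit Types (a b x y : T) (A S L : set T).

Definition is_geodesic a b (gamma : R -> T) : Prop :=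
  [/\ gamma 0 = a, gamma (mdist a b) = b &
      {in `[0, mdist a b] &, forall s t, mdist (gamma s) (gamma t) = `|s - t|}].

Definition geodesic_space : Prop :=
  forall a b, exists gamma, is_geodesic a b gamma.

(* Since metric spaces are Hausdorff and [0, 1] is compact, an injective
   continuous map from [0, 1] is automatically a homeomorphism onto its image. *)
Definition is_arc a b A : Prop :=
  exists gamma : R -> T,
    [/\ {within `[0, 1], continuous gamma}, {in `[0, 1] &, injective gamma},
        gamma 0 = a, gamma 1 = b & gamma @` `[0, 1] = A].

(* The empty space is excluded: an empty tree would map equivariantly to
   every tree, making compatibility and common refinement vacuous. *)
Definition rtree : Prop :=
  [/\ [set: T] !=set0, geodesic_space &
      forall a b, a <> b -> exists! A, is_arc a b A].

(* The segment [a, b], as the union of the geodesics from a to b; in an R-tree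
   this is the image of any one of them, and [set a] when a = b. *)
Definition segment a b : set T :=
  [set x | exists gamma,
    is_geodesic a b gamma /\ (gamma @` `[0, mdist a b]) x].

Definition subtree S : Prop :=
  S !=set0 /\ forall a b, S a -> S b -> segment a b `<=` S.

(* For subsets of a line, such as intersections of two axes in an R-tree, the
   length is the diameter. *)
Definition finite_length S : Prop :=
  exists M : R, forall x y, S x -> S y -> mdist x y <= M.

End MetricTrees.

Arguments rtree {R} T.

Record Gtree (R : realType) (G : groupType) : Type := MkGtree {
  carrier :> metricType R;
  gact : G -> carrier -> carrier;
  carrier_rtree : rtree carrier;
  gact1 : forall x, gact 1%g x = x;
  gactM : forall g h x, gact (g * h)%g x = gact g (gact h x);
  gact_isometry : forall g x y, mdist (gact g x) (gact g y) = mdist x y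
}.

Section GTrees.
Variables (R : realType) (G : groupType).
Implicit Type T : Gtree R G.

Definition minimal_tree T : Prop :=
  forall S : set T, subtree S ->
    (forall (g : G) (x : T), S x -> S (gact g x)) -> S = setT.

Definition hyperbolic T (g : G) : Prop :=
  exists x0 : T, 0 < mdist x0 (gact g x0) /\
    forall x : T, mdist x0 (gact g x0) <= mdist x (gact g x).

Definition is_axis T (g : G) (L : set T) : Prop :=
  exists (line : R -> T) (tau : R),
    [/\ forall s t, mdist (line s) (line t) = `|s - t|, range line = L,
        0 < tau & forall t, gact g (line t) = line (t + tau)].

Definition irreducible_tree T : Prop :=
  exists (g h : G) (A B : set T),
    [/\ hyperbolic T g, hyperbolic T h, is_axis g A, is_axis h B &
        finite_length (A `&` B)].

Definition equivariant T T' (f : T -> T') : Prop :=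
  forall (g : G) (x : T), f (gact g x) = gact g (f x).

Definition preserves_alignment T T' (f : T -> T') : Prop :=
  forall a b : T, f @` segment a b = segment (f a) (f b).

Definition refines T T' : Prop :=
  exists f : T -> T', equivariant f /\ preserves_alignment f.

Definition compatible T T' : Prop :=
  exists That : Gtree R G, refines That T /\ refines That T'.

End GTrees.

(* Main.v *)
From HB Require Import structures.
From mathcomp Require Import all_boot all_order all_algebra.
From mathcomp Require Import boolp classical_sets reals topology normedtype.
From mathcomp Require Import lra.
Require Import Defs.

(** Over four points, an R-tree determines at most one nontrivial splitting into
    pairs.  A sum of tree metrics on a set X is again four-point as soon as no two
    of the summands split four points of X in different ways, and this condition
    only involves pairs of summands: in terms of half-spaces h of T_i and k of T_j,
    one of the four quadrants (h or its opposite) x (k or its opposite) is missed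
    by X.  Call such a subset X of the product of the T_i coherent.

    A coherent G-invariant set which is maximal for inclusion is closed and stable
    under medians, and its gaps could be filled with midpoints; hence it is
    geodesic for the sum metric, so it is an R-tree, and its projections to the
    T_i are collapse maps.

    To get a nonempty coherent invariant set, take the orbit of a point (p_i) such
    that any two p_i, p_j are images of one point of a common refinement of T_i and
    T_j.  Such a point arises as the stable value of the medians of u_n x, v_n x,
    w_n x, where the sequences u, v, w in G go to infinity in every T_i and
    converge to the three distinct ends a^+, a^-, b^+ of T_0 for a pair (a, b)
    witnessing irreducibility: collapse maps commute with medians. *)

Set Implicit Arguments.
Unset Strict Implicit.
Unset Printing Implicit Defensive.

Import Order.TTheory GRing.Theory Num.Theory.
Import numFieldNormedType.Exports.

Local Open Scope classical_set_scope.
Local Open Scope ring_scope.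

(** * Four-point metric spaces *)

Definition betw (R : realType) (T : metricType R) (a x b : T) : Prop :=
  mdist a x + mdist x b = mdist a b.

Definition four_point (R : realType) (T : metricType R) : Prop :=
  forall x y z w : T,
    mdist x y + mdist z w <= mdist x z + mdist y w \/
    mdist x y + mdist z w <= mdist x w + mdist y z.

Definition has_between (R : realType) (T : metricType R) : Prop :=
  forall (a b : T) t, 0 <= t <= mdist a b ->
    exists x, mdist a x = t /\ betw a x b.

Definition is_median (R : realType) (T : metricType R) (a b c m : T) : Prop :=
  [/\ betw a m b, betw a m c & betw b m c].

(* [lra] sees [mdist x y] and [mdist y x] as unrelated atoms, so distances are
   first put in one orientation. *)
Ltac sym_pair x y :=
  rewrite ?(metric_sym y x);
  repeat match goal with H : context [mdist y x] |- _ =>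
    rewrite (metric_sym y x) in H end.
Ltac triangles x y z :=
  move: (metric_triangle x y z) (metric_triangle x z y)
    (metric_triangle y x z).
Ltac triangle_facts x y z :=
  triangles x y z; sym_pair x y; sym_pair x z; sym_pair y z; move=> ? ? ?.
Ltac quad_facts x y z w :=
  triangles x y z; triangles x y w; triangles x z w; triangles y z w;
  sym_pair x y; sym_pair x z; sym_pair x w; sym_pair y z; sym_pair y w;
  sym_pair z w; do 12! move=> ?.

Section FourPoint.
Variables (R : realType) (T : metricType R).
Implicit Types (a b c m p q x y : T).

Lemma mdist_le0_eq x y : mdist x y <= 0 -> x = y.
Proof.
by move=> h; apply: mdist_positivity; apply/eqP; rewrite eq_le h mdist_ge0.
Qed.

Lemma betwC a x b : betw a x b -> betw b x a.
Proof. by rewrite /betw addrC (metric_sym x) (metric_sym a x) (metric_sym a b). Qed.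

Lemma betw_l a b : betw a a b.
Proof. by rewrite /betw mdistxx add0r. Qed.

Lemma betw_r a b : betw a b b.
Proof. by rewrite /betw mdistxx addr0. Qed.

Lemma betw_trans a x y b : betw a x b -> betw x y b -> betw a y b /\ betw a x y.
Proof. by rewrite /betw; quad_facts a x y b => ? ?; split; lra. Qed.

Hypothesis fp : four_point T.

Lemma betw_uniq a b x y :
  betw a x b -> betw a y b -> mdist a x = mdist a y -> x = y.
Proof.
rewrite /betw => ax ay e; apply: mdist_le0_eq.
by case: (fp x y a b) => ?; quad_facts a b x y; lra.
Qed.

Lemma betw_dist a b x y : betw a x b -> betw a y b ->
  mdist a x <= mdist a y -> betw a x y.
Proof.
rewrite /betw => ax ay e.
by case: (fp x y a b) => ?; quad_facts a b x y; lra.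
Qed.

Lemma betw_self a x : betw a x a -> x = a.
Proof.
by rewrite /betw mdistxx metric_sym => e; apply: mdist_le0_eq; move: (mdist_ge0 x a); lra.
Qed.

Lemma median_uniq a b c m n : is_median a b c m -> is_median a b c n -> m = n.
Proof.
rewrite /is_median => -[h1 h2 h3] [k1 k2 k3]; apply: (betw_uniq h1 k1).
move: h1 h2 h3 k1 k2 k3; rewrite /betw (metric_sym m c) (metric_sym m b).
by rewrite (metric_sym n c) (metric_sym n b); lra.
Qed.

Lemma median_exists a b c : has_between T -> exists m, is_median a b c m.
Proof.
move=> hb; have [|m [am]] := hb a b ((mdist a b + mdist a c - mdist b c) / 2).
  by triangle_facts a b c; apply/andP; split; lra.
rewrite /is_median /betw => abm; exists m.
by case: (fp m c a b) => ?; quad_facts a b c m; split; lra.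
Qed.

Lemma betw_swap p a b c : betw a p b -> mdist a c < mdist a p -> betw c p b.
Proof.
by rewrite /betw => h l; case: (fp a b p c) => ?; quad_facts a b c p; lra.
Qed.

Lemma betw_cover p a b c : betw a p b -> betw a p c \/ betw c p b.
Proof.
rewrite /betw => h.
by case: (fp a b p c) => ?; [right|left]; quad_facts a b c p; lra.
Qed.

Lemma disjoint_pairing a b c d : mdist a b + mdist c d < mdist a c + mdist b d ->
  mdist a c + mdist b d = mdist a d + mdist b c.
Proof.
move=> h.
by case: (fp a c b d) => ?; case: (fp a d b c) => ?; quad_facts a b c d; lra.
Qed.

Definition halfspace := (T * T * R)%type.
Implicit Types h k : halfspace.

Definition inh h x : Prop := mdist h.1.1 x - mdist h.1.2 x < h.2.
Definition opp h : halfspace := (h.1.2, h.1.1, - h.2).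

Lemma oppK h : opp (opp h) = h.
Proof. by case: h => [[p q] s]; rewrite /opp /= opprK. Qed.

Lemma inh_opp h x : inh h x -> ~ inh (opp h) x.
Proof. by rewrite /inh /= => ? ?; lra. Qed.

Lemma inh_convex h x m y : betw x m y -> inh h x -> inh h y -> inh h m.
Proof.
case: h => [[p q] s]; rewrite /betw /inh /= => b hx hy.
by case: (fp p m x y) => ?; quad_facts x m y p; quad_facts x m y q; lra.
Qed.

Lemma inh_coconvex h x m y : betw x m y -> inh h m -> inh h x \/ inh h y.
Proof.
case: h => [[p q] s] b hm; case: (pselect (inh (p, q, s) x)); first by left.
case: (pselect (inh (p, q, s) y)); first by right.
move: b hm; rewrite /betw /inh /= => b hm /negP + /negP; rewrite -!leNgt => hy hx.
by case: (fp q m x y) => ?; quad_facts x m y p; quad_facts x m y q; lra.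
Qed.

Lemma inh_open h x : inh h x -> exists e, 0 < e /\
  forall y, mdist x y <= e -> inh h y.
Proof.
case: h => [[p q] s]; rewrite /inh /= => hx.
exists ((s - (mdist p x - mdist q x)) / 3); split; first by lra.
by move=> y e; move: (metric_triangle p x y) (metric_triangle q y x); rewrite (metric_sym y x); lra.
Qed.

Lemma inh_separate a b c d :
  mdist a b + mdist c d < mdist a c + mdist b d ->
  exists h, [/\ inh h a, inh h b, inh (opp h) c & inh (opp h) d].
Proof.
move=> lt; have e := disjoint_pairing lt; quad_facts a b c d.
have [x [ax xb dx cx]] : exists s, [/\ - mdist a c < s, mdist a b - mdist b c < s,
    s < mdist a c & s < mdist a d - mdist c d].
  pose u := Num.max (- mdist a c) (mdist a b - mdist b c).
  pose v := Num.min (mdist a c) (mdist a d - mdist c d).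
  have uv : u < v by rewrite /u /v gt_max !lt_min; apply/andP; split; apply/andP; split; lra.
  have : - mdist a c <= u by rewrite /u le_max lexx.
  have : mdist a b - mdist b c <= u by rewrite /u le_max lexx orbT.
  have : v <= mdist a c by rewrite /v ge_min lexx.
  have : v <= mdist a d - mdist c d by rewrite /v ge_min lexx orbT.
  by move=> *; exists ((u + v) / 2); split; lra.
exists (a, c, x); rewrite /inh /= !mdistxx (metric_sym c a) (metric_sym c b).
by split; lra.
Qed.

End FourPoint.

(** * Paths in four-point spaces *)

Section Continuity.
Variables (R : realType) (T : metricType R).

Lemma within_continuous_mdistP (A : set R) (f : R -> T) :
  {within A, continuous f} <->
  forall s, A s -> forall e, 0 < e -> exists d, 0 < d /\
    forall t, A t -> `|s - t| < d -> mdist (f s) (f t) < e.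
Proof.
split=> [/subspace_continuousP cf s As e e0|H].
  have /(@metricType_numDomainType.cvgrPdist_lt R T) := cf s As.
  move=> /(_ e e0); rewrite near_withinE => /nbhs_ballP [d /= d0 dA].
  by exists d; split => // t At st; apply: dA.
apply/subspace_continuousP => s As.
apply/(@metricType_numDomainType.cvgrPdist_lt R T) => e e0.
rewrite near_withinE; have [d [d0 dA]] := H s As e e0.
by apply/nbhs_ballP; exists d => //= t st At; apply: dA.
Qed.

Lemma lipschitz_within_continuous (A : set R) (K : R) (f : R -> T) : 0 < K ->
  (forall s t, A s -> A t -> mdist (f s) (f t) <= K * `|s - t|) ->
  {within A, continuous f}.
Proof.
move=> K0 fL; apply/within_continuous_mdistP => s As e e0.
exists (e / K); split; first exact: divr_gt0.
move=> t At; rewrite ltr_pdivlMr // mulrC; exact/le_lt_trans/(fL _ _ As At).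
Qed.

End Continuity.

Lemma lipschitz_comp_continuous (R : realType) (T : metricType R) (A : set R)
    (f : R -> T) (F : T -> R) :
  (forall x y, `|F x - F y| <= mdist x y) ->
  {within A, continuous f} -> {within A, continuous (F \o f)}.
Proof.
move=> FL /within_continuous_mdistP cf.
apply/(@within_continuous_mdistP R R^o) => s As e e0.
have [d [d0 dA]] := cf s As e e0; exists d; split => // t At st.
suff : `|F (f t) - F (f s)| < e by [].
by apply: le_lt_trans (FL _ _) _; rewrite metric_sym; exact: dA.
Qed.

Section Separation.
Variables (R : realType) (T : metricType R).
Hypothesis fp : four_point T.

Lemma path_meets_between (s t : R) (f : R -> T) (m : T) : s <= t ->
  {within `[s, t], continuous f} -> betw (f s) m (f t) ->
  exists2 r, r \in `[s, t] & f r = m.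
Proof.
move=> st cf; set a := f s; set b := f t => bm.
(* distance to [m], counted negatively on the side of [a] *)
pose F x := if `[< betw a m x >] then mdist m x else - mdist m x.
have cross x y : ~ betw a m x -> betw a m y -> mdist m x + mdist m y <= mdist x y.
  move=> nx; rewrite /betw => my; rewrite leNgt; apply/negP => xy; apply: nx.
  rewrite /betw; case: (fp a y x m) => ?; quad_facts a m x y; lra.
have FL x y : `|F x - F y| <= mdist x y.
  have hx := mdist_ge0 m x; have hy := mdist_ge0 m y.
  rewrite /F; case: asboolP => mx; case: asboolP => my; rewrite ler_norml.
  - by triangle_facts m x y; apply/andP; split; lra.
  - by have := cross _ _ my mx; rewrite (metric_sym y x) => ?; apply/andP; split; lra.
  - by have := cross _ _ mx my => ?; apply/andP; split; lra.
  - by triangle_facts m x y; apply/andP; split; lra.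
have [||r rst Fr] := @IVT R (F \o f) s t 0 st.
- exact: lipschitz_comp_continuous FL cf.
- have Fa : F a <= 0.
    rewrite /F; case: asboolP => [am|_]; last by rewrite oppr_le0 mdist_ge0.
    by rewrite (betw_self am) mdistxx.
  have Fb : 0 <= F b by rewrite /F asboolT // mdist_ge0.
  by rewrite /= ge_min le_max Fa Fb orbT.
exists r => //; apply/esym/mdist_le0_eq.
by move: Fr; rewrite /F /=; case: asboolP => _ ?; lra.
Qed.

End Separation.

(** * R-trees are the geodesic four-point spaces *)

Section RtreeToFourPoint.
Variables (R : realType) (T : metricType R).
Implicit Types (a b c m o x y : T).

Lemma geodesic_betw a b g t : is_geodesic a b g -> 0 <= t <= mdist a b ->
  mdist a (g t) = t /\ betw a (g t) b.
Proof.
move=> [g0 gd gi] /andP[t0 td].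
have e1 : mdist a (g t) = t.
  by rewrite -{1}g0 gi ?in_itv /= ?lexx ?t0 ?mdist_ge0 // sub0r normrN ger0_norm.
split=> //; rewrite /betw e1 -{1}gd gi ?in_itv /= ?lexx ?t0 ?td ?mdist_ge0 //.
by rewrite ler0_norm ?subr_le0 // opprB addrC subrK.
Qed.

Definition geodesic_image a b (g : R -> T) : set T := g @` `[0, mdist a b].

Lemma concat_is_arc a o c g1 g2 : a <> c ->
  is_geodesic a o g1 -> is_geodesic o c g2 ->
  (forall x, geodesic_image a o g1 x -> geodesic_image o c g2 x -> x = o) ->
  is_arc a c (geodesic_image a o g1 `|` geodesic_image o c g2).
Proof.
move=> ac G1 G2 meet; have [g10 g1d g1i] := G1; have [g20 g2d g2i] := G2.
pose d1 := mdist a o; pose d2 := mdist o c; pose D := d1 + d2.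
have d10 : 0 <= d1 := mdist_ge0 _ _; have d20 : 0 <= d2 := mdist_ge0 _ _.
have D0 : 0 < D.
  apply: lt_le_trans (metric_triangle a o c).
  by rewrite mdist_gt0; apply/eqP.
pose g s := if s <= d1 then g1 s else g2 (s - d1).
have gL s t : 0 <= s -> s <= t -> t <= D -> mdist (g s) (g t) <= t - s.
  move=> s0 st tD; rewrite /g; case: (leP s d1) => sd; case: (leP t d1) => td.
  - rewrite g1i ?in_itv /= ?s0 ?sd ?td ?(le_trans s0 st) //.
    by rewrite distrC ger0_norm ?subr_ge0.
  - have [+ _] := geodesic_betw (t := t - d1) G2 ltac:(apply/andP; split; rewrite -/d2; rewrite /D in tD; lra).
    have [+ +] := geodesic_betw (t := s) G1 ltac:(by rewrite s0).
    rewrite /betw -/d1; have := metric_triangle (g1 s) o (g2 (t - d1)).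
    lra.
  - lra.
  - rewrite g2i ?in_itv /= -/d2; last 2 first.
      by rewrite /D in tD; apply/andP; split; lra.
      by rewrite /D in tD; apply/andP; split; lra.
    by rewrite opprB addrA subrK distrC ger0_norm ?subr_ge0.
have uD u : 0 <= u <= 1 -> 0 <= u * D <= D.
  by case/andP=> u0 u1; rewrite mulr_ge0 ?(ltW D0) //= ler_piMl // ltW.
exists (fun u => g (u * D)); split.
- apply: (@lipschitz_within_continuous _ _ _ D) => // s t /=.
  rewrite !in_itv /= => /uD/andP[s0 s1] /uD/andP[t0 t1].
  wlog st : s t s0 s1 t0 t1 / s <= t.
    move=> H; case/orP: (le_total s t) => st; first exact: H.
    by rewrite metric_sym distrC; exact: H.
  apply: le_trans (gL _ _ _ _ _) _ => //; first by rewrite ler_pM2r.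
  by rewrite distrC ger0_norm ?subr_ge0 // mulrBr !(mulrC D).
- have inj s t : 0 <= s -> s < t -> t <= D -> g s = g t -> t <= s.
    move=> s0 st tD; rewrite /g; case: (leP s d1) => sd; case: (leP t d1) => td E.
    + have := g1i s t; rewrite !in_itv /= s0 sd td (le_trans s0 (ltW st)) => /(_ isT isT).
      by rewrite E mdistxx => /esym/normr0P; rewrite subr_eq0 => /eqP; lra.
    + have tt : 0 <= t - d1 <= d2 by rewrite /D in tD; apply/andP; split; lra.
      have e : g2 (t - d1) = o.
        apply: meet; last by exists (t - d1) => //=; rewrite in_itv.
        by exists s => //=; rewrite in_itv /= s0.
      have [+ _] := geodesic_betw G2 tt; rewrite e mdistxx; lra.
    + by clear E; lra.
    + have := g2i (s - d1) (t - d1); rewrite !in_itv /= -/d2.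
      have -> : 0 <= s - d1 <= d2 by rewrite /D in tD; apply/andP; split; lra.
      have -> : 0 <= t - d1 <= d2 by rewrite /D in tD; apply/andP; split; lra.
      move=> /(_ isT isT); rewrite E mdistxx => /esym/normr0P; rewrite subr_eq0 => /eqP.
      lra.
  move=> s t; rewrite !in_itv /= => /uD/andP[s0 s1] /uD/andP[t0 t1] E.
  apply: (mulIf (lt0r_neq0 D0)); case: (ltgtP (s * D) (t * D)) => // st.
  + by have := inj _ _ s0 st t1 E; rewrite leNgt st.
  + by have := inj _ _ t0 st s1 (esym E); rewrite leNgt st.
- by rewrite mul0r /g d10.
- rewrite mul1r /g; case: leP => dD.
    have e : d2 = 0 by rewrite /D in dD; lra.
    have <- : o = c by apply: mdist_le0_eq; rewrite -/d2 e.
    by rewrite /D e addr0.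
  by rewrite /D addrC addKr.
- apply/seteqP; split=> [x [u /=]|x].
    rewrite in_itv /= => /uD /andP[u0 u1]; rewrite /g; case: leP => ud <-.
      by left; exists (u * D) => //=; rewrite in_itv /= u0.
    right; exists (u * D - d1) => //=; rewrite in_itv /= -/d2.
    by move: u1; rewrite {2}/D => u1; apply/andP; split; lra.
  have inD s : 0 <= s <= D -> [set` `[0, 1]] (s / D).
    by case/andP=> s0 sD; rewrite /= in_itv /= divr_ge0 ?(ltW D0) //= ler_pdivrMr // mul1r.
  case=> -[s /=]; rewrite in_itv /= -?/d1 -?/d2 => /andP[s0 sd] <-.
    exists (s / D); first by apply: inD; rewrite s0 /D /=; lra.
    by rewrite divfK ?gt_eqF // /g sd.
  exists ((s + d1) / D); first by apply: inD; rewrite /D; apply/andP; split; lra.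
  rewrite divfK ?gt_eqF // /g; case: leP => sd1; last by rewrite addrK.
  have -> : s = 0 by lra.
  by rewrite add0r g20.
Qed.

Lemma geodesic_const a : is_geodesic a a (fun=> a).
Proof.
split=> // s t; rewrite mdistxx !in_itv /= => /andP[s0 s1] /andP[t0 t1].
have -> : s = 0 by lra.
have -> : t = 0 by lra.
by rewrite subrr normr0.
Qed.

Hypothesis rt : rtree T.

Lemma arc_uniq a b A B : a <> b -> is_arc a b A -> is_arc a b B -> A = B.
Proof.
move=> ab hA hB; have [_ _ /(_ _ _ ab) [C [_ u]]] := rt.
by rewrite -(u _ hA) -(u _ hB).
Qed.

Lemma geodesic_image_l a b g : is_geodesic a b g -> geodesic_image a b g a.
Proof. by case=> g0 _ _; exists 0; rewrite //= in_itv /= lexx mdist_ge0. Qed.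

Lemma geodesic_image_r a b g : is_geodesic a b g -> geodesic_image a b g b.
Proof. by case=> _ g1 _; exists (mdist a b); rewrite //= in_itv /= lexx mdist_ge0. Qed.

Lemma geodesic_image_betw a b g x : is_geodesic a b g ->
  geodesic_image a b g x -> betw a x b.
Proof.
by move=> G [t /=]; rewrite in_itv /= => t01 <-; case: (geodesic_betw G t01).
Qed.

Lemma geodesic_is_arc a b g : a <> b -> is_geodesic a b g ->
  is_arc a b (geodesic_image a b g).
Proof.
move=> ab G; have := concat_is_arc ab G (geodesic_const b).
have -> : geodesic_image b b (fun=> b) = [set b].
  apply/seteqP; split=> [x [t _ <-//]|x /= ->].
  exact: (geodesic_image_l (geodesic_const b)).
move=> /(_ ltac:(by move=> x _ ->)); congr is_arc.
by apply/seteqP; split=> [x [//|->]|x ?]; [exact: geodesic_image_r|left].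
Qed.

Lemma geodesic_imageE a b g x : is_geodesic a b g -> betw a x b ->
  geodesic_image a b g x.
Proof.
move=> G bx; have [_ gs _] := rt.
have [ab|ab] := pselect (a = b).
  subst b; rewrite (betw_self bx); exact: geodesic_image_l.
have [g1 G1] := gs a x; have [g2 G2] := gs x b.
rewrite (arc_uniq ab (geodesic_is_arc ab G) (concat_is_arc ab G1 G2 _)).
  by left; exact: geodesic_image_r.
move=> y /(geodesic_image_betw G1) + /(geodesic_image_betw G2).
move: bx; rewrite /betw => *; apply: mdist_le0_eq.
quad_facts a b x y; lra.
Qed.

Lemma rtree_betw_uniq a b x y : betw a x b -> betw a y b ->
  mdist a x = mdist a y -> x = y.
Proof.
have [_ gs _] := rt; have [g G] := gs a b.
move=> /(geodesic_imageE G)[s /= + <-] /(geodesic_imageE G)[t /= + <-].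
rewrite !in_itv /= => /(geodesic_betw G)[-> _] /(geodesic_betw G)[-> _].
by move->.
Qed.

Lemma rtree_has_between : has_between T.
Proof.
move=> a b t t01; have [_ gs _] := rt; have [g G] := gs a b.
by exists (g t); apply: geodesic_betw.
Qed.

(* The median is the last common point of the geodesics from [a]. *)
Lemma rtree_median a b c : exists m, is_median a b c m.
Proof.
have [bc|bc] := pselect (b = c).
  by subst c; exists b; split; [exact: betw_r|exact: betw_r|exact: betw_l].
have [_ gs _] := rt; have [gb Gb] := gs a b; have [gc Gc] := gs a c.
pose l := Num.min (mdist a b) (mdist a c).
have l0 : 0 <= l by rewrite le_min !mdist_ge0.
have lb : l <= mdist a b by rewrite ge_min lexx.
have lc : l <= mdist a c by rewrite ge_min lexx orbT.
pose E := [set t | 0 <= t <= l /\ gb t = gc t].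
have E0 : E 0 by split; [rewrite lexx|case: Gb => ->; case: Gc => ->].
have hE : has_sup E by split; [exists 0|exists l => t [/andP[]]].
pose t := sup E.
have t0 : 0 <= t by exact: ub_le_sup hE.2 _ E0.
have tl : t <= l by apply: ge_sup; [exists 0|move=> s [/andP[]]].
have Et : gb t = gc t.
  apply: mdist_le0_eq; apply/ler_addgt0Pl => e e0; rewrite addr0.
  have [s Es st] := @sup_adherent _ _ (e / 2) (divr_gt0 e0 (ltr0n _ 2)) hE.
  have le_st : s <= t by exact: ub_le_sup hE.2 _ Es.
  case: Es => /andP[s0 sl] Es.
  have [_ _ gbi] := Gb; have [_ _ gci] := Gc.
  have := metric_triangle (gb t) (gb s) (gc t).
  rewrite {2}Es gbi ?gci ?in_itv /= ?s0 ?t0 /= ?(le_trans tl) ?(le_trans sl) //.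
  rewrite (distrC s t) ger0_norm ?subr_ge0 // -/t in st *.
  lra.
have [tb mb] := geodesic_betw (t := t) Gb ltac:(by rewrite t0 (le_trans tl)).
have [tc mc] := geodesic_betw (t := t) Gc ltac:(by rewrite t0 (le_trans tl)).
rewrite -Et in tc mc; exists (gb t); set m := gb t in tb mb mc *; split=> //.
have [g1 G1] := gs b m; have [g2 G2] := gs m c; have [g G] := gs b c.
apply: (geodesic_image_betw G).
rewrite (arc_uniq bc (geodesic_is_arc bc G) (concat_is_arc bc G1 G2 _)).
  by left; exact: geodesic_image_r.
move=> y /(geodesic_image_betw G1)/betwC yb /(geodesic_image_betw G2) yc.
have [ayb amy] := betw_trans mb yb; have [ayc _] := betw_trans mc yc.
have yl : mdist a y <= l.
  by rewrite le_min; move: ayb ayc; rewrite /betw => <- <-; rewrite !lerDl !mdist_ge0.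
have y0 := mdist_ge0 a y.
have [ub vb] := geodesic_betw (t := mdist a y) Gb ltac:(by rewrite y0 (le_trans yl)).
have [uc vc] := geodesic_betw (t := mdist a y) Gc ltac:(by rewrite y0 (le_trans yl)).
have Ey : E (mdist a y).
  split; first by rewrite y0.
  by rewrite (rtree_betw_uniq vb ayb ub) (rtree_betw_uniq vc ayc uc).
have yt : mdist a y <= t by exact: ub_le_sup hE.2 _ Ey.
by apply/esym/mdist_le0_eq; move: amy; rewrite /betw; lra.
Qed.

(* Geodesics from [w] to two points agree up to their Gromov product. *)
Lemma rtree_four_point : four_point T.
Proof.
have step x y z w m n : is_median w x z m -> is_median w z y n ->
    mdist w m <= mdist w n -> mdist x y + mdist z w <= mdist x z + mdist y w.
  move=> [wmx wmz xmz] [wnz wny zny] le.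
  have [p [wp wpn]] : exists p, mdist w p = mdist w m /\ betw w p n.
    by apply: rtree_has_between; rewrite le mdist_ge0.
  have wpz : betw w p z.
    by move: wpn wnz; rewrite /betw => *; quad_facts w p n z; lra.
  have pm : p = m := rtree_betw_uniq wpz wmz wp.
  subst p; move: wpn wny wmx wmz xmz (metric_triangle m n y) (metric_triangle x m y).
  by rewrite /betw (metric_sym y w) (metric_sym z w) (metric_sym m x); lra.
move=> x y z w; have [m Mm] := rtree_median w x z.
have [n Mn] := rtree_median w z y.
case/orP: (le_total (mdist w m) (mdist w n)) => le; first by left; exact: step le.
right; have := step y x z w n m; rewrite (metric_sym y x).
rewrite (addrC (mdist y z)); apply=> //.
  by case: Mn => ? ? ?; split=> //; apply: betwC.
by case: Mm => ? ? ?; split=> //; apply: betwC.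
Qed.

End RtreeToFourPoint.

Section FourPointToRtree.
Variables (R : realType) (T : metricType R).
Hypotheses (fp : four_point T) (hb : has_between T).
Implicit Types (a b c m x y : T).

Lemma four_point_geodesic_space : geodesic_space T.
Proof.
move=> a b; have /choice[g gP] : forall t, exists x,
    0 <= t <= mdist a b -> mdist a x = t /\ betw a x b.
  move=> t; have [t01|nt] := pselect (is_true (0 <= t <= mdist a b)).
    by have [x hx] := hb t01; exists x.
  by exists a => /nt.
exists g; split.
- by apply/esym/mdist_le0_eq; rewrite (gP 0 _).1 // lexx mdist_ge0.
- have [|+ +] := gP (mdist a b); first by rewrite lexx mdist_ge0.
  rewrite /betw => e h; apply: mdist_le0_eq; lra.
- move=> s t; rewrite !in_itv /=; wlog st : s t / s <= t.
    move=> H hs ht; case/orP: (le_total s t) => st; first exact: H.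
    by rewrite metric_sym distrC; exact: H.
  move=> /gP[es bs] /gP[et bt].
  have := betw_dist fp bs bt; rewrite es et => /(_ st); rewrite /betw es et => h.
  by rewrite distrC ger0_norm ?subr_ge0 //; lra.
Qed.

Lemma segmentE a b : segment a b = [set x | betw a x b].
Proof.
apply/seteqP; split=> [x [g [G]]|x /= bx]; first exact: geodesic_image_betw.
have [g G] := four_point_geodesic_space a b; exists g; split=> //.
have dx : 0 <= mdist a x <= mdist a b.
  by rewrite mdist_ge0 -bx lerDl mdist_ge0.
exists (mdist a x); first by rewrite /= in_itv.
by have [e bg] := geodesic_betw G dx; apply: betw_uniq bg bx _.
Qed.

Lemma arc_image a b A : is_arc a b A -> A = [set x | betw a x b].
Proof.
move=> [f [cf fi f0 f1 <-]].
have sub s t : 0 <= s -> t <= 1 -> {within `[s, t], continuous f}.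
  move=> s0 t1; apply: continuous_subspaceW cf => u /=.
  by rewrite !in_itv /= => /andP[? ?]; apply/andP; split; lra.
apply/seteqP; split=> [x [r /=]|x /= bx]; last first.
  have := path_meets_between fp (m := x) ler01 cf; rewrite f0 f1.
  by move=> /(_ bx)[r r01 <-]; exists r.
rewrite in_itv /= => /andP[r0 r1] rx.
have [m [abm axm bxm]] := median_exists fp a b x hb.
have [] := path_meets_between fp (m := m) r0 (sub _ _ (lexx _) r1).
  by rewrite f0 rx.
move=> s; rewrite in_itv /= => /andP[s0 sr] sm.
have [] := path_meets_between fp (m := m) r1 (sub _ _ r0 (lexx _)).
  by rewrite f1 rx; exact: betwC.
move=> t; rewrite in_itv /= => /andP[rt t1] tm.
have st : s = t.
  apply: fi; rewrite ?sm ?tm // in_itv /=; apply/andP; split; lra.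
have sr' : s = r by lra.
by rewrite -rx -sr' sm.
Qed.

Lemma four_point_rtree : [set: T] !=set0 -> rtree T.
Proof.
move=> T0; split=> //; first exact: four_point_geodesic_space.
move=> a b ab; exists [set x | betw a x b]; split; last first.
  by move=> A /arc_image ->.
have [g G] := four_point_geodesic_space a b.
by have H := geodesic_is_arc ab G; rewrite -(arc_image H).
Qed.

End FourPointToRtree.

(** * Coherent subsets of a product of trees *)

Section SumMetric.
Variables (R : realType) (I : finType) (T : I -> metricType R).

Definition sum_prod : Type := forall i, T i.

HB.instance Definition _ := gen_eqMixin sum_prod.
HB.instance Definition _ := gen_choiceMixin sum_prod.

Definition sum_dist (x y : sum_prod) : R := \sum_i mdist (x i) (y i).

Lemma sum_distxx x : sum_dist x x = 0.
Proof. by rewrite /sum_dist big1 // => i _; rewrite mdistxx. Qed.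

Lemma sum_dist_positivity x y : sum_dist x y = 0 -> x = y.
Proof.
move=> /psumr_eq0P e; apply: functional_extensionality_dep => i.
by apply: mdist_positivity; apply: e => // j _; exact: mdist_ge0.
Qed.

Lemma sum_distC x y : sum_dist x y = sum_dist y x.
Proof. by apply: eq_bigr => i _; rewrite metric_sym. Qed.

Lemma sum_dist_triangle y x z : sum_dist x z <= sum_dist x y + sum_dist y z.
Proof. by rewrite -big_split; apply: ler_sum => i _; exact: metric_triangle. Qed.

HB.instance Definition _ := @isMetric.Build R sum_prod sum_dist
  sum_distxx sum_dist_positivity sum_distC sum_dist_triangle.

Lemma mdist_sumE (x y : sum_prod) : mdist x y = \sum_i mdist (x i) (y i).
Proof. by []. Qed.

Lemma mdist_coord_le (x y : sum_prod) i : mdist (x i) (y i) <= mdist x y.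
Proof.
rewrite mdist_sumE (bigD1 i) //= lerDl; apply: sumr_ge0 => j _.
exact: mdist_ge0.
Qed.

Lemma betw_sumP (x y z : sum_prod) :
  betw x y z <-> forall i, betw (x i) (y i) (z i).
Proof.
rewrite /betw !mdist_sumE -big_split /=; split=> [e i|e]; last exact: eq_bigr.
have /psumr_eq0P : \sum_i (mdist (x i) (y i) + mdist (y i) (z i)
    - mdist (x i) (z i)) = 0 by rewrite sumrB e subrr.
move=> /(_ _ i isT) h; apply/eqP; rewrite -subr_eq0; apply/eqP; apply: h.
by move=> j _; rewrite subr_ge0 metric_triangle.
Qed.

End SumMetric.

Section SubMetric.
Variables (R : realType) (M : metricType R) (X : set M).

Definition sub_metric : Type := {x : M | X x}.

HB.instance Definition _ := gen_eqMixin sub_metric.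
HB.instance Definition _ := gen_choiceMixin sub_metric.

Definition sub_dist (x y : sub_metric) : R := mdist (sval x) (sval y).

Lemma sub_distxx x : sub_dist x x = 0.
Proof. exact: mdistxx. Qed.

Lemma sub_dist_positivity x y : sub_dist x y = 0 -> x = y.
Proof.
case: x y => [x Xx] [y Yy] /mdist_positivity /= e; subst y.
by rewrite (Prop_irrelevance Xx Yy).
Qed.

Lemma sub_distC x y : sub_dist x y = sub_dist y x.
Proof. exact: metric_sym. Qed.

Lemma sub_dist_triangle y x z : sub_dist x z <= sub_dist x y + sub_dist y z.
Proof. exact: metric_triangle. Qed.

HB.instance Definition _ := @isMetric.Build R sub_metric sub_dist
  sub_distxx sub_dist_positivity sub_distC sub_dist_triangle.

Lemma mdist_subE (x y : sub_metric) : mdist x y = mdist (sval x) (sval y).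
Proof. by []. Qed.

End SubMetric.

Section Coherent.
Variables (R : realType) (I : finType) (T : I -> metricType R).
Hypotheses (fp : forall i, four_point (T i)) (hb : forall i, has_between (T i)).
Local Notation P := (sum_prod T).
Implicit Types (X Y : set P) (x y z a b c : P).

Definition quad X i (h : halfspace (T i)) j (k : halfspace (T j)) : Prop :=
  exists x, [/\ X x, inh h (x i) & inh k (x j)].

Definition coherent X : Prop :=
  forall i j (h : halfspace (T i)) (k : halfspace (T j)), i <> j ->
    quad X h k -> quad X h (opp k) -> quad X (opp h) k ->
    quad X (opp h) (opp k) -> False.

Definition hull X : set P := [set c |
  forall i j (h : halfspace (T i)) (k : halfspace (T j)), i <> j ->
    inh h (c i) -> inh k (c j) -> quad X h k].

Lemma hull_sub X : X `<=` hull X.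
Proof. by move=> x Xx i j h k _ hx kx; exists x. Qed.

Lemma hull_coherent X : coherent X -> coherent (hull X).
Proof.
move=> cX i j h k ij.
have H (h' : halfspace (T i)) (k' : halfspace (T j)) :
    quad (hull X) h' k' -> quad X h' k'.
  by case=> x [Xx hx kx]; apply: Xx.
by move=> /H q1 /H q2 /H q3 /H q4; apply: (cX i j h k).
Qed.

Lemma coherent_four_point X x y z w : coherent X -> X x -> X y -> X z -> X w ->
  mdist x y + mdist z w <= mdist x z + mdist y w \/
  mdist x y + mdist z w <= mdist x w + mdist y z.
Proof.
move=> cX Xx Xy Xz Xw; rewrite !mdist_sumE -!big_split /=.
pose S1 i := mdist (x i) (y i) + mdist (z i) (w i).
pose S2 i := mdist (x i) (z i) + mdist (y i) (w i).
pose S3 i := mdist (x i) (w i) + mdist (y i) (z i).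
have [[i lti]|H] := pselect (exists i, S2 i < S1 i); last first.
  left; apply: ler_sum => i _; rewrite leNgt; apply/negP => lti.
  by apply: H; exists i.
right; apply: ler_sum => j _; rewrite leNgt; apply/negP => ltj.
have ij : i <> j.
  move=> ij; subst j; move: lti ltj; rewrite /S1 /S2.
  by case: (fp (x i) (y i) (z i) (w i)) => h1 h2 h3; have := lt_le_trans h2 h1;
     have := lt_le_trans h3 h1; rewrite ltxx.
have [h [hx hz hy hw]] := inh_separate (@fp i) (a := x i) (b := z i) (c := y i)
  (d := w i) lti.
have [k [kx kw ky kz]] := inh_separate (@fp j) (a := x j) (b := w j) (c := y j)
  (d := z j) ltac:(by rewrite (metric_sym (w j) (z j))).
by apply: (cX i j h k ij); [exists x|exists z|exists w|exists y].
Qed.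

(* Majority vote: two of the three points lie in [h], two in [k]. *)
Lemma hull_median X x y z m : X x -> X y -> X z ->
  (forall i, is_median (x i) (y i) (z i) (m i)) -> hull X m.
Proof.
move=> Xx Xy Xz med i j h k ij hm km.
have [xyi xzi yzi] := med i; have [xyj xzj yzj] := med j.
have := inh_coconvex (@fp i) xyi hm; have := inh_coconvex (@fp i) xzi hm.
have := inh_coconvex (@fp i) yzi hm; have := inh_coconvex (@fp j) xyj km.
have := inh_coconvex (@fp j) xzj km; have := inh_coconvex (@fp j) yzj km.
have qx : inh h (x i) -> inh k (x j) -> quad X h k by exists x.
have qy : inh h (y i) -> inh k (y j) -> quad X h k by exists y.
have qz : inh h (z i) -> inh k (z j) -> quad X h k by exists z.
tauto.
Qed.

Lemma hull_closed X c : (forall e, 0 < e -> exists x, X x /\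
  forall i, mdist (c i) (x i) <= e) -> hull X c.
Proof.
move=> H i j h k ij hc kc; have [e [e0 he]] := inh_open hc.
have [d [d0 kd]] := inh_open kc.
have [|x [Xx cx]] := H (Num.min e d); first by rewrite lt_min e0.
exists x; split=> //.
  by apply: he; apply: le_trans (cx i) _; rewrite ge_min lexx.
by apply: kd; apply: le_trans (cx j) _; rewrite ge_min lexx orbT.
Qed.

Lemma coherent_bigcup (F : set (set P)) :
  (forall A, F A -> coherent A) ->
  (forall A B, F A -> F B -> exists C, [/\ F C, A `<=` C & B `<=` C]) ->
  coherent (\bigcup_(A in F) A).
Proof.
move=> cF dF i j h k ij [x [[A FA Ax] hx kx]] [y [[B FB By] hy ky]].
move=> [z [[C FC Cz] hz kz]] [w [[E FE Ew] hw kw]].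
have [U [FU AU BU]] := dF A B FA FB; have [V [FV CV EV]] := dF C E FC FE.
have [W [FW UW VW]] := dF U V FU FV.
apply: (cF W FW i j h k ij).
- by exists x; split=> //; apply/UW/AU.
- by exists y; split=> //; apply/UW/BU.
- by exists z; split=> //; apply/VW/CV.
- by exists w; split=> //; apply/VW/EV.
Qed.

End Coherent.

(** * Maximal coherent subsets *)

Section MaximalCoherent.
Variables (R : realType) (G : groupType) (I : finType) (T : I -> Gtree R G).
Local Notation P := (sum_prod (fun i => carrier (T i))).
Implicit Types (X Y : set P) (x y z a b c : P).

Let fp i : four_point (T i) := rtree_four_point (carrier_rtree (T i)).
Let hb i : has_between (T i) := rtree_has_between (carrier_rtree (T i)).

Definition sum_act (g : G) x : P := fun i => gact g (x i).

Lemma sum_act1 x : sum_act 1%g x = x.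
Proof. by apply: functional_extensionality_dep => i; rewrite /sum_act gact1. Qed.

Lemma sum_actM g h x : sum_act (g * h)%g x = sum_act g (sum_act h x).
Proof. by apply: functional_extensionality_dep => i; rewrite /sum_act gactM. Qed.

Lemma sum_act_isometry g x y : mdist (sum_act g x) (sum_act g y) = mdist x y.
Proof. by rewrite !mdist_sumE; apply: eq_bigr => i _; rewrite gact_isometry. Qed.

Lemma gactKV (U : Gtree R G) g (u : U) : gact g (gact g^-1%g u) = u.
Proof. by rewrite -gactM mulgV gact1. Qed.

Lemma gactK (U : Gtree R G) g (u : U) : gact g^-1%g (gact g u) = u.
Proof. by rewrite -gactM mulVg gact1. Qed.

Lemma betw_gact (U : Gtree R G) g (u v w : U) :
  betw (gact g u) (gact g v) (gact g w) <-> betw u v w.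
Proof. by rewrite /betw !gact_isometry. Qed.

Definition invariant X : Prop := forall g x, X x -> X (sum_act g x).

Definition act_half i (g : G) (h : halfspace (T i)) : halfspace (T i) :=
  (gact g h.1.1, gact g h.1.2, h.2).

Lemma inh_act i g (h : halfspace (T i)) u : inh (act_half g h) u <-> inh h (gact g^-1%g u).
Proof. by rewrite /inh /= -{1 2}(gactKV g u) !gact_isometry. Qed.

Lemma hull_invariant X : invariant X -> invariant (hull X).
Proof.
move=> iX g c hc i j h k ij hg kg.
have [||x [Xx hx kx]] := hc i j (act_half g^-1%g h) (act_half g^-1%g k) ij.
- by apply/inh_act; rewrite invgK.
- by apply/inh_act; rewrite invgK.
exists (sum_act g x); split; first exact: iX.
- by move/inh_act: hx; rewrite invgK.
- by move/inh_act: kx; rewrite invgK.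
Qed.

Definition maximal_coherent X : Prop :=
  [/\ coherent X, invariant X &
      forall Y, coherent Y -> invariant Y -> X `<=` Y -> Y `<=` X].

Lemma maximal_coherent_exists X0 : coherent X0 -> invariant X0 ->
  exists X, X0 `<=` X /\ maximal_coherent X.
Proof.
move=> cX0 iX0.
pose Q := [set X | coherent (X `|` X0) /\ invariant (X `|` X0)].
have [F FQ Ftot|X [[cX iX] maxX]] := @Zorn_bigcup P Q.
  pose F' := [set X0] `|` [set X `|` X0 | X in F].
  rewrite /Q /=; have -> : (\bigcup_(X in F) X) `|` X0 = \bigcup_(X in F') X.
    apply/seteqP; split=> x.
      case=> [[X FX Xx]|X0x]; last by exists X0 => //; left.
      by exists (X `|` X0); [right; exists X|left].
    case=> _ [->|[X FX <-]]; first by right.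
    by case=> [Xx|]; [left; exists X|right].
  split.
    apply: coherent_bigcup => [_ [->//|[X FX <-]]|]; first by case: (FQ _ FX).
    move=> _ _ [->|[X FX <-]] [->|[Y FY <-]].
    - by exists X0; split=> //; left.
    - by exists (Y `|` X0); split=> [||//]; [right; exists Y|right].
    - by exists (X `|` X0); split=> [|//|]; [right; exists X|right].
    - case: (Ftot _ _ FX FY) => s.
        exists (Y `|` X0); split=> //; first by right; exists Y.
        exact: setSU.
      exists (X `|` X0); split=> //; first by right; exists X.
      exact: setSU.
  move=> g x [A FA Ax]; exists A => //; case: FA Ax => [->|[X FX <-]].
    exact: iX0.
  by case: (FQ _ FX) => _; apply.
exists (X `|` X0); split; first by right.
split=> // Y cY iY XY x Yx.
have X0Y : X0 `<=` Y by move=> y ?; apply: XY; right.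
apply: contrapT => nx; apply: (maxX Y); last first.
  have YE : Y `|` X0 = Y by apply/seteqP; split=> z; [case=> // /X0Y|left].
  by rewrite /Q /= YE.
split; first by move=> y ?; apply: XY; left.
by move=> /(_ x Yx) Xx; apply: nx; left.
Qed.

Section WithMaximal.
Variables (X : set P) (maxX : maximal_coherent X).

Let cX : coherent X. Proof. by case: maxX. Qed.
Let iX : invariant X. Proof. by case: maxX. Qed.

Lemma maximal_hull c : hull X c -> X c.
Proof.
case: maxX => _ _; apply; [exact: hull_coherent|exact: hull_invariant|].
exact: hull_sub.
Qed.

Lemma maximal_median a b c : X a -> X b -> X c ->
  exists m, X m /\ forall i, is_median (a i) (b i) (c i) (m i).
Proof.
move=> Xa Xb Xc; have [m mP] : exists m : P, forall i, is_median (a i) (b i) (c i) (m i).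
  have H i : {m | is_median (a i) (b i) (c i) m}.
    exact/cid/(median_exists (@fp i) _ _ _ (@hb i)).
  by exists (fun i => sval (H i)) => i; exact: svalP (H i).
by exists m; split=> //; apply: maximal_hull; exact: hull_median mP.
Qed.

Definition gap a b c : Prop :=
  [/\ X a, X b, (forall x, X x -> betw a x b -> x = a \/ x = b) &
      forall i, betw (a i) (c i) (b i) /\
        mdist (a i) (c i) = mdist (a i) (b i) / 2].

Lemma gapC a b c : gap a b c -> gap b a c.
Proof.
case=> Xa Xb e m; split=> // [x Xx /betwC /e|i].
  by move=> /(_ Xx)[]; [right|left].
have [B D] := m i; split; first exact: betwC.
by move: B; rewrite /betw D (metric_sym (c i)) (metric_sym (a i) (b i)); lra.
Qed.

Lemma gap_act g a b c : gap a b c -> gap (sum_act g a) (sum_act g b) (sum_act g c).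
Proof.
case=> Xa Xb e m; split; [exact: iX|exact: iX| |] => [x Xx B|i]; last first.
  by rewrite /sum_act betw_gact !gact_isometry.
have E : x = sum_act g (sum_act g^-1%g x) by rewrite -sum_actM mulgV sum_act1.
have B' : betw a (sum_act g^-1%g x) b by move: B; rewrite {1}E /betw !sum_act_isometry.
by rewrite E; case: (e _ (iX g^-1%g Xx) B') => ->; [left|right].
Qed.

Lemma gap_side a b c x : gap a b c -> X x -> betw x a b \/ betw x b a.
Proof.
case=> Xa Xb e _ Xx; have [m [Xm mm]] := maximal_median Xa Xb Xx.
have amb : betw a m b by apply/betw_sumP => i; case: (mm i).
case: (e _ Xm amb) => E; subst m; [left|right]; apply/betw_sumP => i.
  by case: (mm i) => _ _ /betwC.
by case: (mm i) => _ /betwC.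
Qed.

Lemma gap_diagonal a b c i j (h : halfspace (T i)) (k : halfspace (T j)) :
  gap a b c -> inh h (c i) -> inh k (c j) -> ~ quad X h k ->
  [/\ inh h (a i), inh k (b j), ~ inh h (b i) & ~ inh k (a j)] \/
  [/\ inh h (b i), inh k (a j), ~ inh h (a i) & ~ inh k (b j)].
Proof.
case=> Xa Xb _ m hc kc nq.
have := inh_coconvex (@fp i) (m i).1 hc; have := inh_coconvex (@fp j) (m j).1 kc.
have : ~ (inh h (a i) /\ inh k (a j)) by case=> ? ?; apply: nq; exists a.
have : ~ (inh h (b i) /\ inh k (b j)) by case=> ? ?; apply: nq; exists b.
move=> nb na [ka|kb] [ha|hb']; [by case: na| | |by case: nb].
  by right; split=> // ?; [apply: na|apply: nb].
by left; split=> // ?; [apply: nb|apply: na].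
Qed.

Lemma gap_opposite a b c a' b' c' i j (h : halfspace (T i)) (k : halfspace (T j)) :
  gap a b c -> gap a' b' c' ->
  (forall i, mdist (a i) (b i) = mdist (a' i) (b' i)) ->
  inh h (c i) -> inh k (c j) -> ~ quad X h k ->
  inh (opp h) (c' i) -> inh (opp k) (c' j) -> False.
Proof.
move=> gp gp' dd hc kc nq hc' kc'.
wlog [ha kb nhb nka] : a b gp dd / [/\ inh h (a i), inh k (b j), ~ inh h (b i) & ~ inh k (a j)].
  case: (gap_diagonal gp hc kc nq); first by move=> + H; apply: H.
  move=> [? ? ? ?] /(_ b a (gapC gp)); apply=> // l.
  by rewrite metric_sym dd.
have sideA x : betw x a b -> inh h (x i).
  by move=> /betw_sumP /(_ i) B; case: (inh_coconvex (@fp i) B ha).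
have sideB x : betw x b a -> inh k (x j).
  by move=> /betw_sumP /(_ j) B; case: (inh_coconvex (@fp j) B kb).
have nq' : ~ quad X (opp h) (opp k).
  move=> [x [Xx hx kx]]; case: (gap_side gp Xx).
    by move=> /sideA /inh_opp.
  by move=> /sideB /inh_opp.
wlog [ha' kb'] : a' b' gp' dd / inh (opp h) (a' i) /\ inh (opp k) (b' j).
  case: (gap_diagonal gp' hc' kc' nq'); first by case=> ? ? ? ? H; apply: H gp' dd _.
  case=> ? ? ? ? /(_ b' a' (gapC gp')); apply=> // l.
  by rewrite dd metric_sym.
have [Xa' Xb' _ m'] := gp'.
have aB : betw a' b a.
  by case: (gap_side gp Xa') => // /sideA /inh_opp.
have bA : betw b' a b.
  by case: (gap_side gp Xb') => // /sideB /inh_opp.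
have ab : a i <> b i by move=> e; apply: nhb; rewrite -e.
have ab0 : 0 < mdist (a i) (b i) by rewrite mdist_gt0; apply/eqP.
move/betw_sumP: aB => /(_ i); move/betw_sumP: bA => /(_ i).
have := dd i; rewrite /betw => D1 D2 D3.
have [E1 E2] : mdist (a' i) (b i) <= 0 /\ mdist (b' i) (a i) <= 0.
  case: (@fp i (b' i) (b i) (a i) (a' i)) => D4;
    quad_facts (a i) (b i) (a' i) (b' i); split; lra.
have {}E1 := mdist_le0_eq E1; have {}E2 := mdist_le0_eq E2.
have [B' D'] := m' i; have [_ _ _ /(_ i)[B D]] := gp.
have E : c' i = c i.
  apply: (betw_uniq (@fp i)) B _; first by rewrite -E1 -E2; exact: betwC.
  rewrite D; move: B' D'; rewrite E1 E2 /betw (metric_sym (c' i)) (metric_sym (b i) (a i)).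
  by move=> *; lra.
by move: hc'; rewrite E; exact: inh_opp.
Qed.

(* If [X] misses a quadrant containing a translate of the midpoint [c], then both
   [X] and the orbit of [c] miss the opposite quadrant. *)
Lemma gap_filled a b c : gap a b c -> X c.
Proof.
move=> gp; pose Y := X `|` [set sum_act g c | g in [set: G]].
have [_ _ mX] := maxX; apply: (mX Y); last by right; exists 1%g; rewrite ?sum_act1.
- have opq i j (h : halfspace (T i)) (k : halfspace (T j)) :
      quad Y h k -> quad Y (opp h) (opp k) -> quad X h k.
    case=> x [[Xx|[g _ <-]] hx kx]; first by exists x.
    move=> q'; apply: contrapT => nq.
    have nq' : ~ quad X (opp h) (opp k).
      case=> y [Xy hy ky]; have gpg := gap_act g gp.
      have [[ha kb nhb nka]|[hb' ka nha nkb]] := gap_diagonal gpg hx kx nq.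
        case: (gap_side gpg Xy) => /betw_sumP H.
          by case: (inh_coconvex (@fp i) (H i) ha) => // /inh_opp.
        by case: (inh_coconvex (@fp j) (H j) kb) => // /inh_opp.
      case: (gap_side gpg Xy) => /betw_sumP H.
        by case: (inh_coconvex (@fp j) (H j) ka) => // /inh_opp.
      by case: (inh_coconvex (@fp i) (H i) hb') => // /inh_opp.
    case: q' => y [[Xy|[g' _ <-]] hy ky]; first by apply: nq'; exists y.
    apply: (gap_opposite (gap_act g gp) (gap_act g' gp) _ hx kx nq hy ky).
    by move=> l; rewrite !gact_isometry.
  move=> i j h k ij q1 q2 q3 q4; apply: (cX ij (opq _ _ _ _ q1 q4)).
  + by apply: opq q2 _; rewrite oppK.
  + by apply: opq q3 _; rewrite oppK.
  + by apply: opq q4 _; rewrite !oppK.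
- move=> g x [Xx|[g' _ <-]]; first by left; exact: iX.
  by right; exists (g * g')%g; rewrite ?sum_actM.
- by move=> x; left.
Qed.

Lemma maximal_chain a b x y : X a -> X b -> X x -> X y ->
  betw a x b -> betw a y b -> mdist a x <= mdist a y -> betw a x y.
Proof.
move=> Xa Xb Xx Xy; rewrite /betw => ax ay e; quad_facts a b x y.
by case: (coherent_four_point (@fp) cX Xx Xy Xa Xb) => ?; quad_facts a b x y; lra.
Qed.

(* The point [a'] is the coordinatewise supremum of a chain; it is a limit of
   points of [X], hence belongs to its hull. *)
Lemma maximal_last_before a b t : X a -> X b -> 0 <= t ->
  exists a', [/\ X a', betw a a' b, mdist a a' <= t &
    forall x, X x -> betw a x b -> mdist a x <= t -> mdist a x <= mdist a a'].
Proof.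
move=> Xa Xb t0.
pose It := [set x | [/\ X x, betw a x b & mdist a x <= t]].
have Ia : It a by split; rewrite ?mdistxx //; exact: betw_l.
pose S := [set mdist a x | x in It].
have hS : has_sup S.
  by split; [exists (mdist a a), a|exists t => _ [x [_ _ ?] <-]].
pose Si i := [set mdist (a i) (x i) | x in It].
have hSi i : has_sup (Si i).
  split; first by exists (mdist (a i) (a i)), a.
  exists t => _ [x [_ _ xt] <-]; exact: le_trans (mdist_coord_le _ _ _) xt.
have S0 i : 0 <= sup (Si i).
  apply: ub_le_sup (hSi i).2 _ _; exists a => //; exact: mdistxx.
have Sd i : sup (Si i) <= mdist (a i) (b i).
  apply: ge_sup (hSi i).1 _ => _ [x [_ /betw_sumP /(_ i) B _] <-].
  by rewrite -B lerDl mdist_ge0.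
have [a' a'P] : exists a' : P, forall i, mdist (a i) (a' i) = sup (Si i) /\
    betw (a i) (a' i) (b i).
  have H i : {m | mdist (a i) m = sup (Si i) /\ betw (a i) m (b i)}.
    by apply/cid; apply: hb; rewrite S0 Sd.
  by exists (fun i => sval (H i)) => i; exact: svalP (H i).
have approx e : 0 < e -> exists y, It y /\ forall i, mdist (a' i) (y i) <= e.
  move=> e0; have [_ [y Iy <-] ey] := sup_adherent e0 hS.
  have [Xy By yt] := Iy; exists y; split=> // i.
  have yS : mdist (a i) (y i) <= mdist (a i) (a' i).
    by rewrite (a'P i).1; apply: ub_le_sup (hSi i).2 _ _; exists y.
  have Sy : mdist (a i) (a' i) <= mdist (a i) (y i) + e.
    rewrite (a'P i).1; apply: ge_sup (hSi i).1 _ => _ [x Ix <-].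
    have [Xx Bx xt] := Ix.
    have xS : mdist a x <= sup S by apply: ub_le_sup hS.2 _ _; exists x.
    case/orP: (le_total (mdist a x) (mdist a y)) => xy.
      have /betw_sumP /(_ i) := maximal_chain Xa Xb Xx Xy Bx By xy.
      have := mdist_ge0 (x i) (y i); rewrite /betw; lra.
    have C := maximal_chain Xa Xb Xy Xx By Bx xy.
    move/betw_sumP: (C) => /(_ i); have := mdist_coord_le y x i.
    by move: C; rewrite /betw; lra.
  have := betw_dist (@fp i) (((betw_sumP _ _ _).1 By) i) (a'P i).2 yS.
  by rewrite /betw (metric_sym (a' i)); lra.
exists a'; split.
- apply: maximal_hull; apply: hull_closed => e /approx[y [[Xy _ _] ye]].
  by exists y.
- by apply/betw_sumP => i; case: (a'P i).
- apply/ler_addgt0Pl => e e0.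
  have N0 : 0 < #|I|.+1%:R :> R by rewrite ltr0n.
  have [|y [[_ _ yt] ye]] := approx (e / #|I|.+1%:R); first exact: divr_gt0.
  apply: le_trans (metric_triangle a y a') _; rewrite addrC lerD //.
  rewrite metric_sym mdist_sumE.
  apply: le_trans (ler_sum _ (fun i _ => ye i)) _.
  rewrite sumr_const -(mulr_natr (e / _)) -mulrA ger_pMr // mulrC ler_pdivrMr // mul1r.
  by rewrite ler_nat ltnW // ltnS.
- move=> x Xx Bx xt; rewrite !mdist_sumE; apply: ler_sum => i _.
  rewrite (a'P i).1; apply: ub_le_sup (hSi i).2 _ _.
  by exists x.
Qed.

Lemma maximal_between a b t : X a -> X b -> 0 <= t <= mdist a b ->
  exists x, [/\ X x, mdist a x = t & betw a x b].
Proof.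
move=> Xa Xb /andP[t0 tD].
have [p [Xp Bp pt pmax]] := maximal_last_before Xa Xb t0.
have tD' : 0 <= mdist a b - t by rewrite subr_ge0.
have [q [Xq Bq qt qmax]] := maximal_last_before Xb Xa tD'.
have Bq' := betwC Bq.
have dbE x : betw a x b -> mdist b x = mdist a b - mdist a x.
  by rewrite /betw (metric_sym x b) => <-; rewrite addrC addKr.
have tq : t <= mdist a q by move: qt; rewrite (dbE _ Bq'); lra.
have Bpq : betw a p q.
  by apply: (maximal_chain Xa Xb) => //; exact: le_trans tq.
have [c cP] : exists c : P, forall i, betw (p i) (c i) (q i) /\
    mdist (p i) (c i) = mdist (p i) (q i) / 2.
  have H i : {m | mdist (p i) m = mdist (p i) (q i) / 2 /\ betw (p i) m (q i)}.
    apply/cid; apply: hb; have := mdist_ge0 (p i) (q i).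
    by move=> ?; apply/andP; split; lra.
  by exists (fun i => sval (H i)) => i; case: (svalP (H i)).
have gp : gap p q c.
  split=> // x Xx Bx.
  have [Bx1 Bx2] : betw a x b /\ betw a p x.
    move: Bp Bq' Bpq Bx; rewrite /betw => *.
    by quad_facts a p x q; quad_facts a x q b; split; lra.
  case/orP: (le_total (mdist a x) t) => xt.
    left; apply/esym/mdist_le0_eq; have := pmax x Xx Bx1 xt.
    by move: Bx2; rewrite /betw; lra.
  right; apply: mdist_le0_eq.
  have := qmax x Xx (betwC Bx1); rewrite !dbE // => /(_ ltac:(lra)).
  by move: Bpq Bx Bx2; rewrite /betw; lra.
have Xc := gap_filled gp; have [_ _ e _] := gp.
have pq : p = q.
  have Bc : betw p c q by apply/betw_sumP => i; case: (cP i).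
  case: (e c Xc Bc) => E.
    apply: functional_extensionality_dep => i; apply: mdist_le0_eq.
    by have [_] := cP i; rewrite E mdistxx; lra.
  apply: functional_extensionality_dep => i; apply: mdist_le0_eq.
  by have [_] := cP i; rewrite E; lra.
exists p; split=> //; subst q; lra.
Qed.

Lemma sub_has_between : has_between (sub_metric X).
Proof.
move=> [a Xa] [b Xb] t t01; have [x [Xx ax bx]] := maximal_between Xa Xb t01.
by exists (exist _ x Xx).
Qed.

Lemma sub_four_point : four_point (sub_metric X).
Proof.
move=> [x Xx] [y Xy] [z Xz] [w Xw]; rewrite !mdist_subE.
exact: (coherent_four_point (@fp) cX).
Qed.

Definition sub_act (g : G) (x : sub_metric X) : sub_metric X :=
  exist _ (sum_act g (sval x)) (iX g (svalP x)).

Lemma sub_ext (x y : sub_metric X) : sval x = sval y -> x = y.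
Proof. by move=> e; apply: mdist_le0_eq; rewrite mdist_subE e mdistxx. Qed.

Lemma refinement_of_maximal : X !=set0 ->
  exists T0 : Gtree R G, forall i, refines T0 (T i).
Proof.
move=> [x0 Xx0].
have rt : rtree (sub_metric X).
  apply: four_point_rtree sub_four_point sub_has_between _.
  by exists (exist _ x0 Xx0).
have act1 (x : sub_metric X) : sub_act 1%g x = x by apply: sub_ext; exact: sum_act1.
have actM g h (x : sub_metric X) : sub_act (g * h)%g x = sub_act g (sub_act h x).
  by apply: sub_ext; exact: sum_actM.
have acti g (x y : sub_metric X) : mdist (sub_act g x) (sub_act g y) = mdist x y.
  exact: sum_act_isometry.
exists (MkGtree rt act1 actM acti) => i.
exists (fun x : sub_metric X => sval x i); split=> // a b.
rewrite /= (segmentE (T := T i) (@fp i) (@hb i)).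
rewrite (segmentE sub_four_point sub_has_between).
apply/seteqP; split=> [_ [x /= B <-]|y /= B].
  by move: i; apply/betw_sumP.
have [g G0] := four_point_geodesic_space sub_four_point sub_has_between a b.
pose f (x : sub_metric X) := mdist (sval a i) (sval x i).
have [g0 g1 _] := G0.
have [|||t t01 ft] := @IVT R (f \o g) 0 (mdist a b) (mdist (sval a i) y).
- exact: mdist_ge0.
- apply: lipschitz_comp_continuous => [x x'|].
    apply: le_trans (mdist_coord_le (sval x) (sval x') i); rewrite /f.
    by triangle_facts (sval a i) (sval x i) (sval x' i);
       rewrite ler_norml; apply/andP; split; lra.
  apply: (@lipschitz_within_continuous _ _ _ 1) => // s t s01 t01.
  by have [_ _ gi] := G0; rewrite gi // mul1r.
- rewrite /= g0 g1 /f mdistxx ge_min le_max mdist_ge0 /=.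
  by rewrite -B lerDl mdist_ge0 orbT.
exists (g t); first by move: t01; rewrite in_itv => /(geodesic_betw G0)[].
apply: (betw_uniq (@fp i)) B _ => //.
move: t01; rewrite in_itv => /(geodesic_betw G0)[_ Bg].
exact: ((betw_sumP _ _ _).1 Bg i).
Qed.

End WithMaximal.

End MaximalCoherent.

(** * Lines and projections *)

Ltac norm_lra :=
  repeat match goal with
  | |- context [@Num.norm _ _ ?u] => case: (ger0P u) => ?
  end; lra.

Section Lines.
Variables (R : realType) (T : metricType R).
Hypothesis fp : four_point T.
Implicit Types (a b c d p x y : T) (l : R -> T).

Lemma common_point a b c d : has_between T ->
  mdist a c + mdist b d <= mdist a b + mdist c d ->
  exists z, betw a z b /\ betw c z d.
Proof.
move=> hb le; have [m [amb amc bmc]] := median_exists fp a b c hb.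
exists m; split=> //; move: amb amc bmc; rewrite /betw => *.
by case: (fp m d a b) => ?; case: (fp a d b c) => ?;
  quad_facts a b c d; quad_facts a b c m;
  move: (metric_triangle c m d); sym_pair c m; sym_pair d m;
  sym_pair a m; sym_pair b m; lra.
Qed.

Definition isometric_line l : Prop := forall s t, mdist (l s) (l t) = `|s - t|.

Lemma line_projection l x : isometric_line l ->
  exists s e, 0 <= e /\ forall t, mdist x (l t) = e + `|t - s|.
Proof.
move=> il; set d0 := mdist x (l 0); pose N := d0 + 1.
have d00 : 0 <= d0 := mdist_ge0 _ _.
have dN : d0 + 1 = N by [].
have N0 : 0 < N by rewrite -dN; lra.
clearbody N.
set A := mdist x (l (- N)); set B := mdist x (l N).
have A0 : 0 <= A := mdist_ge0 _ _; have B0 : 0 <= B := mdist_ge0 _ _.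
have AB : 2 * N <= A + B.
  have := metric_triangle (l (- N)) x (l N).
  by rewrite il (metric_sym _ x) -/A -/B; norm_lra.
have AB1 : A <= B + 2 * N.
  by have := metric_triangle x (l N) (l (- N)); rewrite il -/A -/B; norm_lra.
have AB2 : B <= A + 2 * N.
  by have := metric_triangle x (l (- N)) (l N); rewrite il -/A -/B; norm_lra.
exists ((A - B) / 2), ((A + B) / 2 - N); split; first by lra.
move=> t; have [tN|tN] := lerP N t.
  have := metric_triangle x (l N) (l t).
  have e1 : `|N - t| = t - N by norm_lra.
  have e2 : `|0 - t| = t by norm_lra.
  have e3 : `|N - 0| = N by norm_lra.
  by case: (fp x (l N) (l 0) (l t)); rewrite !il ?e1 ?e2 ?e3 -/B -/d0; norm_lra.
have [tN'|tN'] := lerP t (- N).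
  have := metric_triangle x (l (- N)) (l t).
  have e1 : `|- N - t| = - N - t by norm_lra.
  have e2 : `|0 - t| = - t by norm_lra.
  have e3 : `|- N - 0| = N by norm_lra.
  by case: (fp x (l (- N)) (l 0) (l t)); rewrite !il ?e1 ?e2 ?e3 -/A -/d0; norm_lra.
have e1 : `|t - - N| = t + N by norm_lra.
have e2 : `|t - N| = N - t by norm_lra.
have e3 : `|- N - N| = 2 * N by norm_lra.
have := metric_triangle x (l t) (l (- N)); have := metric_triangle x (l t) (l N).
by case: (fp x (l t) (l (- N)) (l N)); rewrite !il ?e1 ?e2 ?e3 -/A -/B; norm_lra.
Qed.

Lemma line_betw l r s t : isometric_line l -> r <= s -> s <= t ->
  betw (l r) (l s) (l t).
Proof.
by move=> il rs st; rewrite /betw !il; norm_lra.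
Qed.

Lemma projections_betw l x y s e s' e' : isometric_line l ->
  (forall t, mdist x (l t) = e + `|t - s|) ->
  (forall t, mdist y (l t) = e' + `|t - s'|) -> s <> s' -> betw x (l s) y.
Proof.
move=> il hx hy ss'; have d0 : 0 < `|s - s'|.
  by rewrite normr_gt0 subr_eq0; apply/eqP.
have := metric_triangle x (l s) y.
rewrite /betw; case: (fp x (l s') y (l s)); rewrite ?(metric_sym (l s') y) ?(metric_sym (l s) y) ?il !hx !hy !subrr normr0;
  rewrite (distrC s' s); lra.
Qed.

Lemma line_projection_stabilises l l' : isometric_line l -> isometric_line l' ->
  finite_length (range l `&` range l') ->
  exists P t0, forall t r, t0 <= t ->
    mdist (l' t) (l r) = mdist (l' t) (l P) + `|r - P|.
Proof.
move=> il il' [M HM].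
have /choice[s /choice[e se]] : forall t, exists s e,
    0 <= e /\ forall r, mdist (l' t) (l r) = e + `|r - s|.
  by move=> t; exact: line_projection.
have dist_s t : mdist (l' t) (l (s t)) = e t.
  by rewrite (se t).2 subrr normr0 addr0.
suff [t0 ht0] : exists t0, forall t, t0 <= t -> s t = s t0.
  exists (s t0), t0 => t r tt; rewrite (se t).2 -(ht0 _ tt) dist_s //.
have onl t1 t2 : t1 < t2 -> s t1 <> s t2 -> l (s t1) = l' (t1 + e t1).
  move=> t12 ss; have B := projections_betw il (se t1).2 (se t2).2 ss.
  have e0 := (se t1).1; have le : e t1 <= t2 - t1.
    by have := mdist_ge0 (l (s t1)) (l' t2); move: B; rewrite /betw dist_s il'; norm_lra.
  apply: (betw_uniq fp B); first by apply: line_betw => //; lra.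
  by rewrite dist_s il' opprD addrA subrr sub0r normrN ger0_norm.
have [[t1 [t2 [t12 ss]]]|H] := pselect (exists t1 t2, t1 < t2 /\ s t1 <> s t2).
  exists (t1 + e t1 + `|M| + 1); set t0 := _ + 1 => t tt.
  have t0E : t0 = t1 + e t1 + `|M| + 1 by [].
  clearbody t0.
  apply: contrapT => ne; have lt : t0 < t.
    by rewrite lt_neqAle tt andbT; apply/eqP => E; apply: ne; rewrite E.
  have E1 := onl _ _ t12 ss; have E0 := onl _ _ lt (fun E => ne (esym E)).
  have := HM (l (s t1)) (l (s t0)).
  have M0 : M <= `|M| := ler_norm M; have e0 := (se t0).1.
  have N0 : 0 <= `|M| := normr_ge0 M.
  have i1 : (range l `&` range l') (l (s t1)).
    by split; [exists (s t1)|exists (t1 + e t1)].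
  have i0 : (range l `&` range l') (l (s t0)).
    by split; [exists (s t0)|exists (t0 + e t0)].
  by move=> /(_ i1 i0); rewrite E1 E0 il'; norm_lra.
exists 0 => t; rewrite le_eqVlt => /orP[/eqP <-//|t0].
by apply: contrapT => ne; apply: H; exists 0, t; split=> // E; apply: ne.
Qed.

Lemma line_far l p t : isometric_line l -> t - mdist (l 0) p <= mdist (l t) p.
Proof.
move=> il; have := metric_triangle (l t) p (l 0); rewrite il subr0 (metric_sym p).
by have := ler_norm t; lra.
Qed.

Lemma line_not_betw l p s t : isometric_line l ->
  mdist (l 0) p < s -> mdist (l 0) p < t -> ~ betw (l s) p (l t).
Proof.
move=> il; have := line_far p s il; have := line_far p t il.
rewrite /betw il (metric_sym p (l t)) => hs ht ps pt.
have d0 := mdist_ge0 (l 0) p.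
by norm_lra.
Qed.

End Lines.

(** * Sequences of group elements going to infinity *)

Lemma eventually_natr (R : realType) (tau K : R) : 0 < tau ->
  exists N, forall n, (N <= n)%N -> K < n%:R * tau.
Proof.
move=> tau0; exists (Num.bound (`|K| / tau)) => n Nn.
apply: le_lt_trans (ler_norm K) _; rewrite -ltr_pdivrMr //.
apply: lt_le_trans (archi_boundP _) _; last by rewrite ler_nat.
by rewrite divr_ge0 ?normr_ge0 // ltW.
Qed.

Section Sequences.
Variables (R : realType) (G : groupType).
Implicit Types (g h : G) (s u v w : nat -> G) (U : Gtree R G).

Definition diverges U u : Prop := forall (x : U) K,
  exists N, forall n, (N <= n)%N -> K < mdist x (gact (u n) x).

Definition growth_le U (k : nat) s : Prop := forall x : U,
  exists C, 0 <= C /\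
    forall n, (0 < n)%N -> mdist x (gact (s n) x) <= C * n%:R ^+ k.

Definition unbounded_powers U g : Prop := forall (x : U) K,
  exists n, K < mdist x (gact (g ^+ n)%g x).

Definition scaled_power k g s (n : nat) : G := (g ^+ (n ^ k.+1) * s n)%g.

Lemma displacement_mul U g h (x : U) :
  mdist x (gact (g * h)%g x) <= mdist x (gact g x) + mdist x (gact h x).
Proof.
rewrite gactM; apply: le_trans (metric_triangle x (gact g x) _) _.
by rewrite gact_isometry.
Qed.

Lemma displacement_pow U g (x : U) n :
  mdist x (gact (g ^+ n)%g x) <= n%:R * mdist x (gact g x).
Proof.
elim: n => [|n IH]; first by rewrite expg0 gact1 mdistxx mul0r.
rewrite expgS; apply: le_trans (displacement_mul g (g ^+ n)%g x) _.
by rewrite -natr1 mulrDl mul1r addrC lerD2r.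
Qed.

(* The displacement of the powers is bounded when the midpoint of [x] and
   [g x] is fixed, and grows linearly otherwise. *)
Lemma displacement_dichotomy U g (x : U) :
  (exists C, 0 <= C /\ forall n, mdist x (gact (g ^+ n)%g x) <= C) \/
  (exists tau, 0 < tau /\ forall n, n%:R * tau <= mdist x (gact (g ^+ n)%g x)).
Proof.
have fp : four_point U := rtree_four_point (carrier_rtree U).
pose a n := mdist x (gact (g ^+ n)%g x).
have a1E : a 1%N = mdist x (gact g x) by rewrite /a expg1.
have a0E : a 0%N = 0 by rewrite /a expg0 gact1 mdistxx.
have shift k n : mdist (gact (g ^+ k)%g x) (gact (g ^+ (k + n))%g x) = a n.
  by rewrite expgnDr gactM gact_isometry.
have [le|lt] := leP (a 2%N) (a 1%N).
  left; set p := gact g x; set q := gact (g ^+ 2)%g x.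
  have px : mdist x p = a 1%N by [].
  have qx : mdist x q = a 2%N by [].
  have pq : mdist p q = a 1%N by have := shift 1%N 1%N; rewrite expg1.
  have d0 : 0 <= a 1%N := mdist_ge0 _ _.
  have [|y [xy]] := rtree_has_between (carrier_rtree U) (a := x) (b := p) (t := a 1%N / 2).
    by rewrite px; apply/andP; split; lra.
  rewrite /betw xy px => yp.
  have gyp : mdist p (gact g y) = a 1%N / 2 by rewrite gact_isometry.
  have gyq : mdist (gact g y) q = a 1%N / 2.
    by rewrite /q expgS expg1 gactM gact_isometry -/p; lra.
  have yq : mdist y q <= a 1%N / 2.
    case: (fp y q x p); rewrite ?(metric_sym y x) ?(metric_sym q p) ?(metric_sym q x);
      by rewrite px ?pq ?qx ?xy; lra.
  have gy : gact g y = y.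
    apply/esym/mdist_le0_eq; case: (fp y (gact g y) q p);
      rewrite ?(metric_sym q p) ?(metric_sym (gact g y) p) ?pq ?gyp ?gyq; lra.
  have gny n : gact (g ^+ n)%g y = y.
    by elim: n => [|n IH]; rewrite ?expg0 ?gact1 // expgS gactM IH.
  exists (2 * mdist x y); split; first by rewrite mulr_ge0 ?mdist_ge0.
  move=> n; apply: le_trans (metric_triangle x y _) _.
  by rewrite -{2}(gny n) gact_isometry (metric_sym y x); lra.
right; exists (a 2%N - a 1%N); split; first by rewrite subr_gt0.
have step n : a n + (a 2%N - a 1%N) <= a n.+1.
  elim: n => [|n IH].
    rewrite a0E; have := metric_triangle x (gact (g ^+ 1)%g x) (gact (g ^+ 2)%g x).
    by rewrite (shift 1%N 1%N) -/(a 2%N) -/(a 1%N); lra.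
  case: (fp x (gact (g ^+ 2)%g x) (gact (g ^+ 1)%g x) (gact (g ^+ n.+2)%g x)).
    rewrite (shift 1%N n.+1) (shift 2%N n) -/(a 1%N) -/(a 2%N); lra.
  rewrite (shift 1%N n.+1) (metric_sym (gact (g ^+ 2)%g x)) (shift 1%N 1%N).
  rewrite -/(a 1%N) -/(a 2%N) -/(a n.+2); lra.
elim=> [|n IH]; first by rewrite mul0r mdist_ge0.
by have := step n; rewrite -natr1 mulrDl mul1r -/(a n.+1); move: IH; rewrite -/(a n); lra.
Qed.

Lemma scaled_power_growth U k g s :
  growth_le U k s -> growth_le U k.+1 (scaled_power k g s).
Proof.
move=> gs x; have [C [C0 Cs]] := gs x.
exists (mdist x (gact g x) + C); split; first by rewrite addr_ge0 ?mdist_ge0.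
move=> n n0; apply: le_trans (displacement_mul _ _ x) _.
rewrite mulrDl; apply: lerD.
  by apply: le_trans (displacement_pow _ _ _) _; rewrite natrX mulrC.
apply: le_trans (Cs n n0) _; apply: ler_wpM2l => //.
by apply: ler_weXn2l; rewrite ?ler1n.
Qed.

Lemma scaled_power_diverges U k g s : growth_le U k s ->
  unbounded_powers U g \/ diverges U s -> diverges U (scaled_power k g s).
Proof.
move=> gs H x K; have [[C [C0 bC]]|[tau [tau0 ltau]]] := displacement_dichotomy g x.
  case: H => [/(_ x C)[n]|/(_ x (K + C))[N NP]].
    by rewrite ltNge bC.
  exists N => n /NP; rewrite /scaled_power gactM => lt.
  have := metric_triangle x (gact (g ^+ (n ^ k.+1))%g x) (gact (g ^+ (n ^ k.+1))%g (gact (s n) x)).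
  have := metric_triangle (gact (g ^+ (n ^ k.+1))%g x) x (gact (g ^+ (n ^ k.+1))%g (gact (s n) x)).
  by have := bC (n ^ k.+1)%N; rewrite gact_isometry (metric_sym (gact _ x) x); lra.
have [C [C0 Cs]] := gs x; have K0 : K <= `|K| := ler_norm K.
have [N NP] := eventually_natr (C + `|K|) tau0.
exists (maxn N 1) => n; rewrite geq_max => /andP[/NP lt n0].
have := ltau (n ^ k.+1)%N; have := Cs n n0.
have := metric_triangle x (gact (scaled_power k g s n) x) (gact (g ^+ (n ^ k.+1))%g x).
rewrite (metric_sym (gact (scaled_power k g s n) x)).
rewrite /scaled_power gactM gact_isometry.
have n1 : 1 <= n%:R ^+ k :> R by rewrite exprn_ege1 // ler1n.
have : n%:R ^+ k * (C + `|K|) < n%:R ^+ k * (n%:R * tau).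
  by rewrite ltr_pM2l // (lt_le_trans ltr01).
have : `|K| <= n%:R ^+ k * `|K| by rewrite ler_peMl.
rewrite natrX exprSr; lra.
Qed.

Variables (I : Type) (c : I -> G).

(* Decreasing powers make the first factor with unbounded powers dominate. *)
Fixpoint iterated_power (l : seq I) : nat -> G :=
  if l is i :: l' then scaled_power (size l') (c i) (iterated_power l')
  else fun=> 1%g.

Lemma iterated_power_growth U l : growth_le U (size l) (iterated_power l).
Proof.
elim: l => [|i l IH]; last exact: scaled_power_growth.
by move=> x; exists 0; split=> // n _; rewrite gact1 mdistxx mul0r.
Qed.

End Sequences.

Lemma iterated_power_diverges (R : realType) (G : groupType) (I : eqType)
    (c : I -> G) (U : Gtree R G) (l : seq I) i :
  i \in l -> unbounded_powers U (c i) -> diverges U (iterated_power c l).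
Proof.
move=> il ui; elim: l il => // j l IH; rewrite in_cons => /orP il.
apply: scaled_power_diverges; first exact: iterated_power_growth.
by case: il => [/eqP <-|/IH]; [left|right].
Qed.

Section Shadows.
Variables (R : realType) (G : groupType) (U : Gtree R G).
Implicit Types (l : R -> U) (p x : U) (s u v w : nat -> G).

Let fp : four_point U := rtree_four_point (carrier_rtree U).

Definition stable_median u v w p : Prop := forall x : U,
  exists N, forall n, (N <= n)%N ->
    is_median (gact (u n) x) (gact (v n) x) (gact (w n) x) p.

Definition eventually_off u p : Prop := forall x : U,
  exists N, forall m n, (N <= m)%N -> (N <= n)%N ->
    ~ betw (gact (u m) x) p (gact (u n) x).

Definition shadows u (al : nat -> U) p : Prop := forall x : U,
  exists N, forall n, (N <= n)%N ->
    2 * mdist (al n) (gact (u n) x) < mdist (al n) p.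

Lemma translation_line_pow l g tau : (forall t, gact g (l t) = l (t + tau)) ->
  forall n t, gact (g ^+ n)%g (l t) = l (t + n%:R * tau).
Proof.
move=> tr; elim=> [|n IH] t; first by rewrite expg0 gact1 mul0r addr0.
by rewrite expgS gactM IH tr -natr1 mulrDl mul1r addrA.
Qed.

Lemma axis_unbounded_powers l g tau : isometric_line l -> 0 < tau ->
  (forall t, gact g (l t) = l (t + tau)) -> unbounded_powers U g.
Proof.
move=> il tau0 tr x K; have [N NP] := eventually_natr (K + 2 * mdist x (l 0)) tau0.
exists N; have := NP N (leqnn N).
have := metric_triangle (l 0) x (gact (g ^+ N)%g (l 0)).
have := metric_triangle x (gact (g ^+ N)%g x) (gact (g ^+ N)%g (l 0)).
have -> : mdist (l 0) (gact (g ^+ N)%g (l 0)) = `|N%:R * tau|.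
  by rewrite (translation_line_pow tr) il !add0r normrN.
rewrite gact_isometry (metric_sym (l 0) x); have := ler_norm (N%:R * tau); lra.
Qed.

Lemma scaled_power_shadows l g tau k s p : isometric_line l -> 0 < tau ->
  (forall t, gact g (l t) = l (t + tau)) -> growth_le U k s ->
  shadows (scaled_power k g s) (fun n => l ((n ^ k.+1)%:R * tau)) p.
Proof.
move=> il tau0 tr gs x; have [C [C0 Cs]] := gs x.
pose D := 2 * mdist (l 0) x + mdist (l 0) p.
have D0 : 0 <= D by rewrite addr_ge0 ?mulr_ge0 ?mdist_ge0.
have [N NP] := eventually_natr (2 * C + D) tau0.
exists (maxn N 1) => n; rewrite geq_max => /andP[/NP lt n0].
have E : l ((n ^ k.+1)%:R * tau) = gact (g ^+ (n ^ k.+1))%g (l 0).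
  by rewrite (translation_line_pow tr) add0r.
apply: lt_le_trans (line_far p _ il).
rewrite E /scaled_power gactM gact_isometry.
have n1 : 1 <= n%:R ^+ k :> R by rewrite exprn_ege1 // ler1n.
have : n%:R ^+ k * (2 * C + D) < n%:R ^+ k * (n%:R * tau).
  by rewrite ltr_pM2l // (lt_le_trans ltr01).
have : D <= n%:R ^+ k * D by rewrite ler_peMl.
have := metric_triangle (l 0) x (gact (s n) x); have := Cs n n0.
rewrite natrX exprSr /D.
lra.
Qed.

Lemma shadows_median u v w al be ga p :
  shadows u al p -> shadows v be p -> shadows w ga p ->
  (exists N, forall n, (N <= n)%N -> is_median (al n) (be n) (ga n) p) ->
  stable_median u v w p.
Proof.
move=> su sv sw [N0 M0] x; have [N1 M1] := su x; have [N2 M2] := sv x.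
have [N3 M3] := sw x; exists (maxn (maxn N0 N1) (maxn N2 N3)) => n.
rewrite !geq_max => /andP[/andP[/M0 [b1 b2 b3] /M1 m1] /andP[/M2 m2 /M3 m3]].
have tr (a a' b b' : U) : betw a p b -> 2 * mdist a a' < mdist a p ->
    2 * mdist b b' < mdist b p -> betw a' p b'.
  move=> B h1 h2; apply: betwC; apply: (betw_swap fp (a := b)) => //.
    apply: betwC; apply: (betw_swap fp (a := a)) => //.
    by have := mdist_ge0 a a'; lra.
  by have := mdist_ge0 b b'; lra.
by split; [apply: tr b1 m1 m2|apply: tr b2 m1 m3|apply: tr b3 m2 m3].
Qed.

Lemma shadows_off u al p : shadows u al p ->
  (exists N, forall m n, (N <= m)%N -> (N <= n)%N -> ~ betw (al m) p (al n)) ->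
  eventually_off u p.
Proof.
move=> su [N0 M0] x; have [N1 M1] := su x.
exists (maxn N0 N1) => m n; rewrite !geq_max => /andP[m0 /M1 m1] /andP[n0 /M1 n1] B.
apply: (M0 m n m0 n0); apply: betwC; apply: (betw_swap fp (a := gact (u n) x)) => //.
  apply: betwC; apply: (betw_swap fp (a := gact (u m) x)) => //.
  by have := metric_triangle (al m) (gact (u m) x) p; rewrite (metric_sym _ (al m)); lra.
by have := metric_triangle (al n) (gact (u n) x) p; rewrite (metric_sym _ (al n)); lra.
Qed.

Lemma stable_median_diverges u v w p (x : U) :
  diverges U u -> diverges U v -> diverges U w ->
  (exists N, forall n, (N <= n)%N ->
    is_median (gact (u n) x) (gact (v n) x) (gact (w n) x) p) ->
  stable_median u v w p.
Proof.
move=> du dv dw [N0 M0] y; pose K := mdist x y + mdist x p.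
have [N1 M1] := du x K; have [N2 M2] := dv x K; have [N3 M3] := dw x K.
exists (maxn (maxn N0 N1) (maxn N2 N3)) => n.
rewrite !geq_max => /andP[/andP[/M0 [b1 b2 b3] /M1 m1] /andP[/M2 m2 /M3 m3]].
have tr g h : betw (gact g x) p (gact h x) -> K < mdist x (gact g x) ->
    K < mdist x (gact h x) -> betw (gact g y) p (gact h y).
  move=> B h1 h2; apply: betwC; apply: (betw_swap fp (a := gact h x)) => //.
    apply: betwC; apply: (betw_swap fp (a := gact g x)) => //; rewrite gact_isometry.
    by have := metric_triangle x p (gact g x); rewrite (metric_sym p) /K in h1 *; lra.
  rewrite gact_isometry.
  by have := metric_triangle x p (gact h x); rewrite (metric_sym p) /K in h2 *; lra.
by split; apply: tr.
Qed.

End Shadows.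

(** * Base points and the common refinement *)

Section Collapse.
Variables (R : realType) (G : groupType).
Implicit Types (U V W : Gtree R G).

Lemma collapse_betw U V (f : U -> V) (a x b : U) : preserves_alignment f ->
  betw a x b -> betw (f a) (f x) (f b).
Proof.
move=> al B; have fpU := rtree_four_point (carrier_rtree U).
have fpV := rtree_four_point (carrier_rtree V).
have hU := rtree_has_between (carrier_rtree U).
have hV := rtree_has_between (carrier_rtree V).
have : (f @` segment a b) (f x) by exists x => //; rewrite segmentE.
by rewrite al (segmentE fpV hV).
Qed.

Lemma collapse_median U V (f : U -> V) (a b c m : U) : preserves_alignment f ->
  is_median a b c m -> is_median (f a) (f b) (f c) (f m).
Proof. by move=> al [? ? ?]; split; apply: collapse_betw. Qed.

Lemma stable_median_transfer U V W (f : U -> V) (f' : U -> W)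
    (u v w : nat -> G) (p : V) :
  equivariant f -> preserves_alignment f ->
  equivariant f' -> preserves_alignment f' ->
  stable_median u v w p ->
  eventually_off u p -> eventually_off v p -> eventually_off w p ->
  diverges W u -> diverges W v -> diverges W w ->
  exists q : W, stable_median u v w q.
Proof.
move=> eqf alf eqf' alf' st ou ov ow du dv dw.
have fpU := rtree_four_point (carrier_rtree U).
have fpV := rtree_four_point (carrier_rtree V).
have hU := rtree_has_between (carrier_rtree U).
have [[x _] _ _] := carrier_rtree U.
have [N0 M0] := st (f x); have [N1 M1] := ou (f x).
have [N2 M2] := ov (f x); have [N3 M3] := ow (f x).
pose N := maxn (maxn N0 N1) (maxn N2 N3).
have [n0 n1 n2 n3] : [/\ (N0 <= N)%N, (N1 <= N)%N, (N2 <= N)%N & (N3 <= N)%N].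
  by split; rewrite /N !leq_max leqnn ?orbT.
have [m Mm] := median_exists fpU (gact (u N) x) (gact (v N) x) (gact (w N) x) hU.
have fm : f m = p.
  apply: (median_uniq fpV) (M0 N n0); rewrite -!eqf; exact: collapse_median.
have move1 (g h k : G) : ~ betw (gact g (f x)) p (gact h (f x)) ->
    betw (gact g x) m (gact k x) -> betw (gact h x) m (gact k x).
  move=> nb B; case: (betw_cover fpU (gact h x) B) => // B'.
  by case: nb; rewrite -fm -!eqf; exact: collapse_betw.
exists (f' m); apply: (stable_median_diverges (x := f' x)) => //.
exists N => n Nn; rewrite -!eqf'; apply: collapse_median => //.
have lt0 := leq_trans n1 Nn; have lt2 := leq_trans n2 Nn; have lt3 := leq_trans n3 Nn.
case: Mm => B1 B2 B3; split.
- apply: (move1 _ _ _ (M1 N n n1 lt0)); apply: betwC.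
  by apply: (move1 _ _ _ (M2 N n n2 lt2)); apply: betwC.
- apply: (move1 _ _ _ (M1 N n n1 lt0)); apply: betwC.
  by apply: (move1 _ _ _ (M3 N n n3 lt3)); apply: betwC.
- apply: (move1 _ _ _ (M2 N n n2 lt2)); apply: betwC.
  by apply: (move1 _ _ _ (M3 N n n3 lt3)); apply: betwC.
Qed.

Lemma compatible_collapses U V : compatible U V ->
  exists (W : Gtree R G) (f : W -> U) (f' : W -> V),
    [/\ equivariant f, preserves_alignment f, equivariant f' &
        preserves_alignment f'].
Proof. by case=> W [[f [? ?]] [f' [? ?]]]; exists W, f, f'. Qed.

Variables (I : finType) (T : I -> Gtree R G).
Local Notation P := (sum_prod (fun i => carrier (T i))).

Lemma stable_medians_coherent (u v w : nat -> G) (p : P) :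
  (forall i j, i <> j -> compatible (T i) (T j)) ->
  (forall i, stable_median u v w (p i)) ->
  coherent [set sum_act g p | g in [set: G]].
Proof.
move=> cT st i j h k ij.
have [W [f [f' [eqf alf eqf' alf']]]] := compatible_collapses (cT i j ij).
have fpW := rtree_four_point (carrier_rtree W).
have hW := rtree_has_between (carrier_rtree W).
have fpi := rtree_four_point (carrier_rtree (T i)).
have fpj := rtree_four_point (carrier_rtree (T j)).
have [z [fz fz']] : exists z, f z = p i /\ f' z = p j.
  have [[x _] _ _] := carrier_rtree W.
  have [N1 M1] := st i (f x); have [N2 M2] := st j (f' x).
  pose N := maxn N1 N2.
  have [m Mm] := median_exists fpW (gact (u N) x) (gact (v N) x) (gact (w N) x) hW.
  exists m; split.
    apply: (median_uniq fpi) (M1 N (leq_maxl _ _)); rewrite -!eqf.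
    exact: collapse_median.
  apply: (median_uniq fpj) (M2 N (leq_maxr _ _)); rewrite -!eqf'.
  exact: collapse_median.
move=> [_ [[g1 _ <-] h1 k1]] [_ [[g2 _ <-] h2 k2]].
move=> [_ [[g3 _ <-] h3 k3]] [_ [[g4 _ <-] h4 k4]].
move: h1 h2 h3 h4 k1 k2 k3 k4; rewrite /sum_act -fz -fz' -!eqf -!eqf'.
move=> h1 h2 h3 h4 k1 k2 k3 k4.
have [le|lt] := leP (mdist (gact g1 z) (gact g3 z) + mdist (gact g2 z) (gact g4 z))
    (mdist (gact g1 z) (gact g2 z) + mdist (gact g3 z) (gact g4 z)).
  have [t [B12 B34]] := common_point fpW hW le.
  have t1 := inh_convex fpi (collapse_betw alf B12) h1 h2.
  have t2 := inh_convex fpi (collapse_betw alf B34) h3 h4.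
  exact: inh_opp t1 t2.
have [t [B13 B24]] := common_point fpW hW (ltW lt).
have t1 := inh_convex fpj (collapse_betw alf' B13) k1 k3.
have t2 := inh_convex fpj (collapse_betw alf' B24) k2 k4.
exact: inh_opp t1 t2.
Qed.

End Collapse.

Lemma axis_line (R : realType) (G : groupType) (U : Gtree R G) (g : G) (L : set U) :
  is_axis g L -> exists l tau, [/\ isometric_line l, range l = L, 0 < tau &
    forall t, gact g (l t) = l (t + tau)].
Proof. by case=> l [tau [? ? ? ?]]; exists l, tau. Qed.

Lemma irreducible_unbounded_powers (R : realType) (G : groupType) (U : Gtree R G) :
  irreducible_tree U -> exists g, unbounded_powers U g.
Proof.
move=> [g [_ [L [_ [_ _ /axis_line[l [tau [il _ t0 tr]]] _ _]]]]].
by exists g; apply: axis_unbounded_powers tr.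
Qed.

(* The point [p] is the median of the ends a^+, a^- and b^+. *)
Lemma irreducible_stable_median (R : realType) (G : groupType) (U : Gtree R G)
    (k : nat) (s : nat -> G) : irreducible_tree U -> growth_le U k s ->
  exists (a b : G) (p : U), let u := scaled_power k a s in
    let v := scaled_power k a^-1%g s in let w := scaled_power k b s in
    [/\ stable_median u v w p, eventually_off u p, eventually_off v p &
        eventually_off w p].
Proof.
move=> [a [b [A [B [_ _ /axis_line[l [ta [il <- ta0 tra]]]
  /axis_line[l' [tb [il' <- tb0 trb]]] fin]]]]] gs.
have fp := rtree_four_point (carrier_rtree U).
have [P [t0 Pt0]] := line_projection_stabilises fp il il' fin.
pose p := l P; pose lm t := l (- t).
have ilm : isometric_line lm by move=> x y; rewrite il -opprD normrN.
have trm t : gact a^-1%g (lm t) = lm (t + ta).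
  by rewrite /lm -{1}(subrK ta (- t)) -tra gactK opprD.
have big (tau K : R) : 0 < tau -> exists N, forall n, (N <= n)%N -> K < (n ^ k.+1)%:R * tau.
  move=> tau0; have [N NP] := eventually_natr K tau0; exists N => n /NP lt.
  apply: lt_le_trans lt _; rewrite ler_pM2r // ler_nat.
  by case: n => // n; rewrite -{1}(expn1 n.+1) leq_pexp2l.
have off (l0 : R -> U) (tau : R) : isometric_line l0 -> 0 < tau -> exists N, forall m n,
    (N <= m)%N -> (N <= n)%N ->
    ~ betw (l0 ((m ^ k.+1)%:R * tau)) p (l0 ((n ^ k.+1)%:R * tau)).
  move=> il0 tau0; have [N NP] := big tau (mdist (l0 0) p) tau0.
  by exists N => m n /NP mN /NP nN; apply: line_not_betw.
have su := scaled_power_shadows p il ta0 tra gs.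
have sv := scaled_power_shadows p ilm ta0 trm gs.
have sw := scaled_power_shadows p il' tb0 trb gs.
exists a, b, p; split.
- apply: (shadows_median su sv sw).
  have [N1 M1] := big ta `|P| ta0; have [N2 M2] := big tb t0 tb0.
  exists (maxn N1 N2) => n; rewrite geq_max => /andP[/M1 lt1 /M2 /ltW lt2].
  have le1 := ler_norm P; have le2 := ler_norm (- P); rewrite normrN in le2.
  have Bt r t : t0 <= t -> betw (l r) p (l' t).
    by move=> tt; apply: betwC; rewrite /betw (Pt0 t r tt) /p il distrC.
  have Ba x : - x <= P -> P <= x -> betw (l x) p (lm x).
    by move=> h1 h2; apply: betwC; exact: (line_betw il h1 h2).
  by split; [apply: Ba; lra|exact: Bt|exact: Bt].
- exact: shadows_off su (off _ _ il ta0).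
- exact: shadows_off sv (off _ _ ilm ta0).
- exact: shadows_off sw (off _ _ il' tb0).
Qed.

Theorem propositionA17 (R : realType) (G : groupType) (n : nat)
    (T : 'I_n -> Gtree R G) :
  finitely_generated G ->
  (forall i, irreducible_tree (T i)) ->
  (forall i, minimal_tree (T i)) ->
  (forall i j, i <> j -> compatible (T i) (T j)) ->
  exists T0 : Gtree R G, forall i, refines T0 (T i).
Proof.
move=> _ irr _ cT.
have [u [v [w [p stp]]]] : exists (u v w : nat -> G)
    (p : sum_prod (fun i => carrier (T i))), forall i, stable_median u v w (p i).
  have [[i0 _]|no] := pselect (exists i0 : 'I_n, True); last first.
    exists (fun=> 1%g), (fun=> 1%g), (fun=> 1%g).
    exists (fun i => False_rect _ (no (ex_intro _ i I))) => i.
    by case: no; exists i.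
  have /choice[c cP] : forall i, exists g, unbounded_powers (T i) g.
    by move=> i; exact: irreducible_unbounded_powers.
  pose s := iterated_power c (enum 'I_n).
  have gs i : growth_le (T i) (size (enum 'I_n)) s by exact: iterated_power_growth.
  have ds i : diverges (T i) s.
    by apply: iterated_power_diverges (cP i); rewrite mem_enum.
  have [a [b [p0 [st ou ov ow]]]] := irreducible_stable_median (irr i0) (gs i0).
  set u := scaled_power _ a s in st ou; set v := scaled_power _ _ s in st ov.
  set w := scaled_power _ b s in st ow.
  have dp g i : diverges (T i) (scaled_power (size (enum 'I_n)) g s).
    by apply: scaled_power_diverges => //; right.
  have H i : exists q : T i, stable_median u v w q.
    have [->|ne] := pselect (i = i0); first by exists p0.
    have [W [f [f' [eqf alf eqf' alf']]]] := compatible_collapses (cT i0 i (nesym ne)).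
    exact: (stable_median_transfer eqf alf eqf' alf' st ou ov ow (dp _ _) (dp _ _) (dp _ _)).
  exists u, v, w, (fun i => sval (cid (H i))) => i; exact: svalP (cid (H i)).
have [||X [X0 maxX]] := @maximal_coherent_exists R G _ T [set sum_act g p | g in [set: G]].
- exact: stable_medians_coherent stp.
- by move=> g _ [h _ <-]; exists (g * h)%g; rewrite ?sum_actM.
apply: (refinement_of_maximal maxX); exists p; apply: X0.
by exists 1%g; rewrite ?sum_act1.
Qed.
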